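(* Let $k$ be a field and let $n$ be a positive integer. Let $\bigwedge(k^{n})$ denote the exterior algebra of the $n$-dimensional $k$-vector space $k^n$. Then $$\mathrm{IT.dist}\,\bigwedge(k^{n}) = n-1 .$$
   Context: For an Artin algebra $\Lambda$, $\mathrm{mod}\,\Lambda$ is the category of finitely generated $\Lambda$-modules (on a fixed side). For $V\in\mathrm{mod}\,\Lambda$, $\mathrm{add}\,V$ is the full subcategory of direct summands of finite direct sums of copies of $V$. For $X\in \mathrm{mod}\,\Lambda$, $\Omega^0(X)=X$, $\Omega^1(X)$ is the kernel of a projective cover $P\to X$, and $\Omega^n(X)=\Omega^1(\Omega^{n-1}(X))$ for $n\ge 2$. $(m,n)$-Igusa-Todorov algebra: for integers $m,n\ge 0$, $\Lambda$ is an $(m,n)$-Igusa-Todorov algebra if there is a module $V\in\mathrm{mod}\,\Lambda$ such that for every $M\in\mathrm{mod}\,\Lambda$ there is an exact sequence $$0\to V_m\to V_{m-1}\to\cdots\to V_1\to V_0\to\Omega^n(M)\to 0$$ with $V_i\in\mathrm{add}\,V$ for all $0\le i\le m$. Igusa-Todorov distance: $\mathrm{IT.dist}\,\Lambda:=\inf\bigcup_{n=0}^{\infty}\{m\ge 0 \mid \Lambda\text{ is an }(m,n)\text{-Igusa-Todorov algebra}\}$. *)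

(* Defs.v *)
From HB Require Import structures.
From mathcomp Require Import all_boot all_order all_algebra.
From mathcomp Require Import boolp.
Set Implicit Arguments.
Unset Strict Implicit.
Unset Printing Implicit Defensive.
Import Order.TTheory GRing.Theory.
Local Open Scope ring_scope.

(* mod L is rendered as the left modules M : lmodType L with fin_gen M. *)

Section Modules.
Variable L : nzRingType.

Definition fin_gen (M : lmodType L) : Prop :=
  exists (d : nat) (g : 'I_d -> M),
    forall x : M, exists c : 'I_d -> L, x = \sum_(i < d) c i *: g i.

Definition surj (A B : Type) (f : A -> B) : Prop := forall y, exists x, f x = y.

Definition exact_at (A B C : lmodType L) (f : A -> B) (g : B -> C) : Prop :=
  forall y : B, g y = 0 <-> exists x : A, f x = y.

Definition in_add (V W : lmodType L) : Prop :=
  exists (d : nat) (W' : lmodType L)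
         (f : {linear (W * W')%type -> {ffun 'I_d -> V}}), bijective f.

Definition projective (P : lmodType L) : Prop :=
  forall (A B : lmodType L) (g : {linear A -> B}) (f : {linear P -> B}),
    surj g -> exists h : {linear P -> A}, forall x, g (h x) = f x.

Definition essential_epi (P X : lmodType L) (p : {linear P -> X}) : Prop :=
  surj p /\
  forall (A : lmodType L) (g : {linear A -> P}), surj (p \o g) -> surj g.

Definition projective_cover (P X : lmodType L) (p : {linear P -> X}) : Prop :=
  [/\ fin_gen P, projective P & essential_epi p].

(* Projective covers, hence syzygies, are only determined up to isomorphism:
   is_syzygy n X K says that K is a model of Omega^n(X). *)
Definition is_syzygy1 (X K : lmodType L) : Prop :=
  exists (P : lmodType L) (p : {linear P -> X}) (i : {linear K -> P}),
    [/\ projective_cover p, injective i & exact_at i p].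

Fixpoint is_syzygy (n : nat) (X K : lmodType L) : Prop :=
  if n is n'.+1 then
    exists Y : lmodType L, is_syzygy n' X Y /\ is_syzygy1 Y K
  else exists f : {linear K -> X}, bijective f.

(* The sequence 0 -> W m -> ... -> W 0 -> X -> 0 is extended by W i = 0 for
   i > m, so that exactness at W m (injectivity of its outgoing map) is the
   instance of exactness at index m. *)
Definition add_resolution (V : lmodType L) (m : nat) (X : lmodType L) : Prop :=
  exists (W : nat -> lmodType L) (d : forall i, {linear W i.+1 -> W i})
         (e : {linear W 0%N -> X}),
    [/\ forall i, (i <= m)%N -> in_add V (W i),
        forall i, (m < i)%N -> forall w : W i, w = 0,
        forall i, exact_at (d i.+1) (d i),
        exact_at (d 0%N) e
      & surj e].

Definition Igusa_Todorov (m n : nat) : Prop :=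
  exists V : lmodType L, fin_gen V /\
    forall M : lmodType L, fin_gen M ->
      exists K : lmodType L, is_syzygy n M K /\ add_resolution V m K.

End Modules.

(* Infimum of a set of naturals, with None standing for inf set0 = +oo. *)
Definition inf_nat (S : nat -> Prop) : option nat :=
  match pselect (exists m, `[< S m >]) with
  | left exS => Some (ex_minn exS)
  | right _ => None
  end.

Lemma inf_natP (S : nat -> Prop) (m : nat) :
  inf_nat S = Some m <-> S m /\ forall j, S j -> (m <= j)%N.
Proof.
rewrite /inf_nat; case: pselect => [exS|nexS]; last first.
  by split=> // -[Sm _]; case: nexS; exists m; apply/asboolP.
case: ex_minnP => j /asboolP Sj minj; split=> [[<-]|[Sm minm]].
  by split=> // i Si; apply: minj; apply/asboolP.
by congr Some; apply/eqP; rewrite eqn_leq minm // minj //; apply/asboolP.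
Qed.

Definition IT_dist (L : nzRingType) : option nat :=
  inf_nat (fun m => exists n, Igusa_Todorov L m n).

(* The exterior algebra of k^n: an element is the family of its coordinates on
   the basis e_S = e_{i_1} ^ ... ^ e_{i_r}, for S = {i_1 < ... < i_r}. Lemmas
   ext_iota_sq and ext_universal give its usual characterization. *)

Definition exterior (k : fieldType) (n : nat) : Type := {ffun {set 'I_n} -> k}.

Section Exterior.
Variables (k : fieldType) (n : nat).
Local Notation E := (exterior k n).
Implicit Types (S T U : {set 'I_n}) (x y z : E).

HB.instance Definition _ := GRing.Lmodule.copy E {ffun {set 'I_n} -> k^o}.

Definition ext_inv S T : nat := \sum_(i in S) \sum_(j in T) (j < i)%N.

(* e_S ^ e_T = ext_sign S T *: e_(S :|: T) *)
Definition ext_sign S T : k :=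
  if [disjoint S & T] then (-1) ^+ ext_inv S T else 0.

Definition ext_base S : E := [ffun U => (U == S)%:R].

Definition ext_mul x y : E :=
  \sum_S \sum_T (ext_sign S T * (x S * y T)) *: ext_base (S :|: T).


Lemma ext_scaleE a x S : (a *: x) S = a * x S.
Proof. by rewrite ffunE. Qed.

Lemma ext_baseE x : x = \sum_S x S *: ext_base S.
Proof.
apply/ffunP => U; rewrite sum_ffunE (bigD1 U) //= big1 ?addr0 => [|S neSU].
  by rewrite !ffunE eqxx /= /GRing.scale /= mulr1.
by rewrite !ffunE eq_sym (negPf neSU) scaler0.
Qed.

Lemma ext_mulDl x y z : ext_mul (x + y) z = ext_mul x z + ext_mul y z.
Proof.
rewrite -big_split; apply: eq_bigr => S _; rewrite -big_split.
by apply: eq_bigr => T _; rewrite ffunE mulrDl mulrDr scalerDl.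
Qed.

Lemma ext_mulDr x y z : ext_mul x (y + z) = ext_mul x y + ext_mul x z.
Proof.
rewrite -big_split; apply: eq_bigr => S _; rewrite -big_split.
by apply: eq_bigr => T _; rewrite ffunE !mulrDr scalerDl.
Qed.

Lemma ext_mulZl a x y : ext_mul (a *: x) y = a *: ext_mul x y.
Proof.
rewrite scaler_sumr; apply: eq_bigr => S _; rewrite scaler_sumr.
by apply: eq_bigr => T _; rewrite scalerA ext_scaleE -mulrA mulrCA.
Qed.

Lemma ext_mulZr a x y : ext_mul x (a *: y) = a *: ext_mul x y.
Proof.
rewrite scaler_sumr; apply: eq_bigr => S _; rewrite scaler_sumr.
by apply: eq_bigr => T _; rewrite scalerA ext_scaleE (mulrCA (x S)) (mulrCA (ext_sign S T)).
Qed.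

Lemma ext_mul0l x : ext_mul 0 x = 0.
Proof. by have := ext_mulZl 0 0 x; rewrite !scale0r. Qed.

Lemma ext_mul0r x : ext_mul x 0 = 0.
Proof. by have := ext_mulZr 0 x 0; rewrite !scale0r. Qed.

Lemma ext_mul_suml (I : Type) (r : seq I) (F : I -> E) y :
  ext_mul (\sum_(i <- r) F i) y = \sum_(i <- r) ext_mul (F i) y.
Proof.
by apply: (big_morph (ext_mul^~ y)) => [x z|]; rewrite ?ext_mulDl ?ext_mul0l.
Qed.

Lemma ext_mul_sumr (I : Type) (r : seq I) (F : I -> E) x :
  ext_mul x (\sum_(i <- r) F i) = \sum_(i <- r) ext_mul x (F i).
Proof.
by apply: (big_morph (ext_mul x)) => [y z|]; rewrite ?ext_mulDr ?ext_mul0r.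
Qed.

Lemma ext_mul_base S T :
  ext_mul (ext_base S) (ext_base T) = ext_sign S T *: ext_base (S :|: T).
Proof.
rewrite /ext_mul (bigD1 S) //= [X in _ + X]big1 ?addr0 => [|S' neS].
  rewrite (bigD1 T) //= [X in _ + X]big1 ?addr0 => [|T' neT].
    by rewrite !ffunE !eqxx !mulr1.
  by rewrite !ffunE (negPf neT) !mulr0 scale0r.
by rewrite big1 // => T' _; rewrite !ffunE (negPf neS) mul0r mulr0 scale0r.
Qed.

Lemma ext_invUl S T U :
  [disjoint S & T] -> ext_inv (S :|: T) U = (ext_inv S U + ext_inv T U)%N.
Proof. by move=> dST; rewrite -bigU //; apply: eq_bigl => i; rewrite !inE. Qed.

Lemma ext_invUr S T U :
  [disjoint T & U] -> ext_inv S (T :|: U) = (ext_inv S T + ext_inv S U)%N.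
Proof.
move=> dTU; rewrite -big_split; apply: eq_bigr => i _ /=.
by rewrite -bigU //; apply: eq_bigl => j; rewrite !inE.
Qed.

Lemma ext_sign_cocycle S T U :
  ext_sign S T * ext_sign (S :|: T) U = ext_sign T U * ext_sign S (T :|: U).
Proof.
rewrite /ext_sign; have -> : [disjoint S :|: T & U] =
    [disjoint S & U] && [disjoint T & U] by rewrite -!setI_eq0 setIUl setU_eq0.
have -> : [disjoint S & T :|: U] = [disjoint S & T] && [disjoint S & U].
  by rewrite -!setI_eq0 setIUr setU_eq0.
case dST: [disjoint S & T]; case dSU: [disjoint S & U];
  case dTU: [disjoint T & U]; rewrite ?(mul0r, mulr0) //=.
by rewrite ext_invUl // ext_invUr // -!exprD addnA addnC.
Qed.

Lemma ext_mulA : associative ext_mul.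
Proof.
move=> x y z; rewrite (ext_baseE x) (ext_mul_suml _ _ (ext_mul y z)).
rewrite (ext_mul_suml _ _ y) (ext_mul_suml _ _ z); apply: eq_bigr => S _.
rewrite (ext_mulZl _ _ (ext_mul y z)) (ext_mulZl _ _ y) (ext_mulZl _ _ z).
congr (_ *: _); rewrite (ext_baseE y) (ext_mul_suml _ _ z).
rewrite !(ext_mul_sumr _ _ (ext_base S)) (ext_mul_suml _ _ z).
apply: eq_bigr => T _; rewrite (ext_mulZl _ _ z) !(ext_mulZr _ (ext_base S)).
rewrite (ext_mulZl _ _ z); congr (_ *: _).
rewrite (ext_baseE z) (ext_mul_sumr _ _ (ext_base T)).
rewrite (ext_mul_sumr _ _ (ext_base S)) (ext_mul_sumr _ _ (ext_mul _ _)).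
apply: eq_bigr => U _; rewrite (ext_mulZr _ (ext_base T)).
rewrite (ext_mulZr _ (ext_base S)) (ext_mulZr _ (ext_mul _ _)).
congr (_ *: _).
by rewrite !ext_mul_base ext_mulZl ext_mulZr !ext_mul_base !scalerA
  ext_sign_cocycle setUA.
Qed.

Lemma ext_sign0l T : ext_sign set0 T = 1.
Proof. by rewrite /ext_sign -setI_eq0 set0I eqxx /ext_inv big_set0. Qed.

Lemma ext_sign0r S : ext_sign S set0 = 1.
Proof.
rewrite /ext_sign -setI_eq0 setI0 eqxx /ext_inv big1 // => i _.
by rewrite big_set0.
Qed.

Lemma ext_mul1l : left_id (ext_base set0) ext_mul.
Proof.
move=> x; rewrite (ext_baseE x) ext_mul_sumr; apply: eq_bigr => S _.
by rewrite ext_mulZr ext_mul_base ext_sign0l set0U scale1r.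
Qed.

Lemma ext_mul1r : right_id (ext_base set0) ext_mul.
Proof.
move=> x; rewrite (ext_baseE x) ext_mul_suml; apply: eq_bigr => S _.
by rewrite ext_mulZl ext_mul_base ext_sign0r setU0 scale1r.
Qed.

Lemma ext_base0_neq0 : ext_base set0 != 0.
Proof.
by apply/eqP => /ffunP/(_ set0)/eqP; rewrite !ffunE eqxx oner_eq0.
Qed.

HB.instance Definition _ := GRing.Zmodule_isNzRing.Build E
  ext_mulA ext_mul1l ext_mul1r ext_mulDl ext_mulDr ext_base0_neq0.
HB.instance Definition _ := GRing.Lmodule_isLalgebra.Build k E
  (fun a x y => esym (ext_mulZl a x y)).
HB.instance Definition _ := GRing.Lalgebra_isAlgebra.Build k E
  (fun a x y => esym (ext_mulZr a x y)).

Definition ext_iota (v : 'rV[k]_n) : E := \sum_(i < n) v 0 i *: ext_base [set i].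

Lemma ext_iota_linear : linear ext_iota.
Proof.
move=> a u v; rewrite scaler_sumr -big_split; apply: eq_bigr => i _ /=.
by rewrite scalerA -scalerDl !mxE.
Qed.

HB.instance Definition _ :=
  GRing.isLinear.Build k 'rV[k]_n E *:%R ext_iota ext_iota_linear.

Lemma ext_mulE x y : x * y = ext_mul x y.
Proof. by []. Qed.

Lemma ext_inv1 i j : ext_inv [set i] [set j] = (j < i)%N.
Proof. by rewrite /ext_inv !big_set1. Qed.

Lemma ext_gen_sq i : ext_base [set i] * ext_base [set i] = 0.
Proof.
by rewrite ext_mulE ext_mul_base /ext_sign disjoints1 inE eqxx scale0r.
Qed.

Lemma ext_gen_anti i j :
  ext_base [set i] * ext_base [set j] = - (ext_base [set j] * ext_base [set i]).
Proof.
have [->|neij] := eqVneq i j; first by rewrite ext_gen_sq oppr0.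
rewrite !ext_mulE !ext_mul_base /ext_sign !disjoints1 !inE [j == i]eq_sym.
rewrite (negPf neij) /= setUC -scaleNr !ext_inv1; congr (_ *: _).
by case: ltngtP neij => [||/val_inj->]; rewrite ?eqxx // expr1 expr0 ?opprK.
Qed.

Lemma sum_alt_sq (A : zmodType) (F : 'I_n -> 'I_n -> A) :
    (forall i, F i i = 0) -> (forall i j, F i j = - F j i) ->
  \sum_i \sum_j F i j = 0.
Proof.
move=> F0 FN; pose G (i j : 'I_n) := if (j < i)%N then F i j else 0.
have FE i j : F i j = G i j - G j i.
  rewrite /G FN; case: ltngtP => [||/val_inj->]; rewrite ?subr0 ?sub0r //.
  by rewrite F0 oppr0.
under eq_bigr do under eq_bigr do rewrite FE.
under eq_bigr do rewrite sumrB.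
by rewrite sumrB [X in _ - X]exchange_big subrr.
Qed.

Lemma ext_iota_sq (v : 'rV[k]_n) : ext_iota v * ext_iota v = 0.
Proof.
rewrite mulr_suml.
under eq_bigr do rewrite mulr_sumr.
apply: sum_alt_sq => [i|i j]; rewrite -!scalerAl -!scalerAr.
  by rewrite ext_gen_sq !scaler0.
by rewrite ext_gen_anti !scalerN !scalerA [v 0 i * _]mulrC.
Qed.

Section Universal.
Variables (A : algType k) (f : {linear 'rV[k]_n -> A}).
Hypothesis f_sq : forall v, f v * f v = 0.

Let a (i : 'I_n) : A := f (delta_mx 0 i).
Let P S : A := \prod_(i <- enum 'I_n | i \in S) a i.

Let a_sq i : a i * a i = 0. Proof. exact: f_sq. Qed.

Let a_anti i j : a i * a j = - (a j * a i).
Proof.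
apply/eqP; rewrite -addr_eq0; apply/eqP.
have := f_sq (delta_mx 0 i + delta_mx 0 j).
by rewrite raddfD /= mulrDl !mulrDr !f_sq addr0 add0r.
Qed.

Let P0 : P set0 = 1.
Proof. by rewrite /P big1 // => i; rewrite inE. Qed.

(* A generator below all of S is the first factor of P (i |: S). *)
Let P_min (i : 'I_n) S : (forall j, j \in S -> (i < j)%N) -> P (i |: S) = a i * P S.
Proof.
move=> ltiS; have : sorted (relpre val ltn) (enum 'I_n).
  by rewrite -sorted_map val_enum_ord iota_ltn_sorted.
have : i \in enum 'I_n by rewrite mem_enum.
rewrite /P; elim: (enum 'I_n) => // j s IHs is_s srt.
have /allP lts : all (fun l : 'I_n => (j < l)%N) s.
  by apply: (order_path_min (leT := relpre val ltn)) srt => ? ? ?; exact: ltn_trans.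
have niS : i \notin S by apply/negP => /ltiS; rewrite ltnn.
rewrite !big_cons in_setU1; have [eji|neji] := eqVneq j i.
  rewrite eji (negPf niS) /=; congr (_ * _).
  rewrite big_seq_cond [RHS]big_seq_cond; apply: eq_bigl => l.
  rewrite in_setU1; case: (l \in s) / boolP => //= /lts.
  by rewrite eji; case: eqP => // ->; rewrite ltnn.
have is_s' : i \in s by move: is_s; rewrite inE eq_sym (negPf neji).
have /negPf-> : j \notin S.
  by apply/negP => /ltiS; rewrite ltnNge ltnW // lts.
exact: IHs is_s' (path_sorted srt).
Qed.

(* Every nonempty S decomposes as i |: S' with i below S'. *)
Let min_ind (Q : {set 'I_n} -> Prop) :
    Q set0 ->
    (forall (i : 'I_n) S, (forall j, j \in S -> (i < j)%N) -> Q S -> Q (i |: S)) ->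
  forall S, Q S.
Proof.
move=> Q0 QU S; have [m] := ubnP #|S|; elim: m S => // m IHm S ltSm.
have [->//|/set0Pn[i0 i0S]] := eqVneq S set0.
case: (arg_minnP (P := [in S]) val i0S) => i /= iS mini.
rewrite -(setD1K iS); apply: QU => [j|].
  by rewrite !inE => /andP[neji jS]; rewrite ltn_neqAle mini // eq_sym neji.
by apply: IHm; rewrite -ltnS; apply: leq_trans ltSm; rewrite [#|S|](cardsD1 i) iS.
Qed.

Let P_gen i U : a i * P U = ext_sign [set i] U *: P (i |: U).
Proof.
elim/min_ind: U => [|j U ltjU IHU].
  by rewrite ext_sign0r scale1r -P_min // => j; rewrite inE.
have njU : j \notin U by apply/negP => /ltjU; rewrite ltnn.
have [ltij|ltji|/val_inj eij] := ltngtP i j.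
- have ltiU l : l \in j |: U -> (i < l)%N.
    by rewrite in_setU1 => /orP[/eqP->//|/ltjU]; exact: ltn_trans.
  rewrite -P_min // /ext_sign disjoints1 ifT; last first.
    by apply/negP => /ltiU; rewrite ltnn.
  rewrite /ext_inv big_set1 big1 ?expr0 ?scale1r // => l /ltiU ltil.
  by rewrite ltnNge ltnW.
- rewrite P_min // mulrA a_anti mulNr -mulrA IHU -scalerAr -scaleNr.
  rewrite (setUCA [set i]) (@P_min j); last first.
    by move=> l; rewrite in_setU1 => /orP[/eqP->//|]; exact: ltjU.
  congr (_ *: _); rewrite /ext_sign !disjoints1 in_setU1 -val_eqE gtn_eqF //=.
  case: (i \in U); rewrite ?oppr0 //=.
  by rewrite /ext_inv !big_set1 (big_setU1 _ njU) ltji exprS mulN1r.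
- rewrite -eij P_min // => [|l]; last by rewrite eij; exact: ltjU.
  by rewrite mulrA a_sq mul0r /ext_sign disjoints1 setU11 scale0r.
Qed.

Let P_mul S T : P S * P T = ext_sign S T *: P (S :|: T).
Proof.
elim/min_ind: S => [|i S ltiS IHS].
  by rewrite P0 mul1r ext_sign0l set0U scale1r.
have niS : i \notin S by apply/negP => /ltiS; rewrite ltnn.
rewrite P_min // -mulrA IHS -scalerAr P_gen scalerA -ext_sign_cocycle -setUA.
suff -> : ext_sign [set i] S = 1 by rewrite mul1r.
rewrite /ext_sign disjoints1 niS /ext_inv big_set1 big1 // => j /ltiS ltij.
by rewrite ltnNge ltnW.
Qed.

Let g (x : E) : A := \sum_S x S *: P S.

Let g_linear : linear g.
Proof.
move=> c x y; rewrite scaler_sumr -big_split; apply: eq_bigr => S _ /=.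
by rewrite scalerA -scalerDl !ffunE.
Qed.

HB.instance Definition _ := GRing.isLinear.Build k E A *:%R g g_linear.

Let g_scale c x : g (c *: x) = c *: g x.
Proof. exact: linearZ. Qed.

Let g_base S : g (ext_base S) = P S.
Proof.
rewrite /g (bigD1 S) //= ffunE eqxx scale1r big1 ?addr0 // => T neTS.
by rewrite ffunE (negPf neTS) scale0r.
Qed.

Let g_monoid : monoid_morphism g.
Proof.
split=> [|x y]; first by rewrite g_base P0.
rewrite (ext_baseE x) mulr_suml !raddf_sum mulr_suml; apply: eq_bigr => S _.
rewrite (ext_baseE y) mulr_sumr !raddf_sum mulr_sumr; apply: eq_bigr => T _.
rewrite -(scalerAl _ (ext_base S : E)) -(scalerAr _ (ext_base S : E)).
rewrite /= !g_scale !g_base -scalerAl -scalerAr P_mul.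
by rewrite ext_mulE ext_mul_base g_scale g_base.
Qed.

HB.instance Definition _ := GRing.isMonoidMorphism.Build E A g g_monoid.

Let g_iota v : g (ext_iota v) = f v.
Proof.
rewrite [in RHS](row_sum_delta v) !raddf_sum; apply: eq_bigr => i _.
rewrite /= g_scale g_base linearZ -[in LHS](setU0 [set i]) P_min ?P0 ?mulr1 // => j.
by rewrite inE.
Qed.

Let g_unique (h : {lrmorphism E -> A}) :
  (forall v, h (ext_iota v) = f v) -> h =1 g.
Proof.
move=> h_iota x; rewrite [in LHS](ext_baseE x) raddf_sum.
apply: eq_bigr => S _; rewrite /= linearZ; congr (_ *: _) => /=.
elim/min_ind: S => [|i S ltiS IHS]; first by rewrite P0; exact: (rmorph1 h).
have niS : i \notin S by apply/negP => /ltiS; rewrite ltnn.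
have -> : P (i |: S) = h (ext_iota (delta_mx 0 i) * ext_base S).
  by rewrite P_min // -IHS rmorphM /= h_iota.
congr (h _).
have -> : ext_iota (delta_mx 0 i) = ext_base [set i].
  rewrite /ext_iota (bigD1 i) //= mxE !eqxx scale1r big1 ?addr0 // => j neji.
  by rewrite mxE (negPf neji) andbF scale0r.
rewrite ext_mulE ext_mul_base /ext_sign disjoints1 niS /ext_inv big_set1 big1.
  by rewrite scale1r.
by move=> j /ltiS ltij; rewrite ltnNge ltnW.
Qed.

Lemma ext_universal :
  exists g : {lrmorphism E -> A}, (forall v, g (ext_iota v) = f v) /\
    forall h : {lrmorphism E -> A}, (forall v, h (ext_iota v) = f v) -> h =1 g.
Proof. by exists g; split; [exact: g_iota | exact: g_unique]. Qed.

End Universal.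
End Exterior.

(* Main.v *)
Require Import Defs.
From HB Require Import structures.
From mathcomp Require Import all_boot all_order all_algebra all_field.
From mathcomp Require Import generic_quotient ring_quotient.
From mathcomp Require Import boolp.
Set Implicit Arguments.
Unset Strict Implicit.
Unset Printing Implicit Defensive.
Import GRing.Theory.
Local Open Scope ring_scope.

(**
  Write L for the exterior algebra of k^n. It is local; its radical is spanned by
  the e_S with S nonempty, and a product of n + 1 elements of the radical is 0.

  Upper bound. Let N be the first syzygy of M, the kernel of a projective cover
  L^d -> M. It lies in the radical of L^d, so the n-th power of the radical kills
  it, and N has a filtration with n semisimple layers, that is, with layers
  direct sums of copies of k ([annihilated_filtered]). Let Omega^a be fixed
  models of the syzygies of k. By the horseshoe lemma, a syzygy of a module
  filtered by j sums of copies of Omega^a is filtered by j sums of copies of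
  Omega^(a+1) ([filtered_syzygy]). If A is the bottom layer of Y, with quotient Y',
  and P -> Y' is a projective cover with kernel Z, then 0 -> Z -> A + P -> Y -> 0
  is exact; hence j + 1 layers give a resolution of length j by sums of L and of
  the Omega^a ([filtered_resolution]), and n - 1 is reached for N.

  Lower bound. Let K be a finite extension of k. A vector lam in K^n acts on the
  scalar extension X_K of an L-module X by an operator of square 0, and the
  generators of L act on its homology H(X). Say that s generators kill X if every
  product of s generators is 0 on H(X).
  - If lam is nonzero, then H vanishes on projective modules ([kills_projective]);
    so if s generators kill a syzygy of X, they kill X ([kills_syzygy]).
  - In a short exact sequence the exponents of the sub and of the middle term
    add up to one for the quotient ([kills_extension]). Thus, if one generator
    kills V, then m + 1 generators kill any module with a resolution of length
    m by direct summands of sums of V ([kills_resolution]).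
  - Given V, one generator kills V for a suitable lam: take lam of largest rank on
    V_K. Matrices of bounded rank near lam have tangent directions that map the
    kernel of lam into its image, and the generators are such directions
    ([max_rank_tangent], [generic_kills]). Enough elements in K are needed here,
    which forces an extension when k is finite.
  - The L-module M of the x in L_K with lam x = 0 is not killed by n - 1
    generators ([ker_op_not_killed]). When K = k, lam acts on M by 0, so H(M) = M,
    which contains lam; and the product of lam with the generators other than e_j
    is nonzero when lam_j is. For a separable K, an element of the tensor
    square of K ([Casimir_exists]) provides a class of H(M) that plays the role of
    lam.
  Hence, if the p-th syzygy of M has a resolution of length m as above, then
  m + 1 generators kill M, and m + 1 > n - 1.
*)

(** * Submodules, quotients and retracts over an arbitrary ring *)

Section LinearMaps.
Variables (L : nzRingType) (A B : lmodType L).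

Definition mk_linear (f : A -> B) (f_lin : linear f) : {linear A -> B} :=
  HB.pack f (GRing.isLinear.Build L A B *:%R f f_lin).

End LinearMaps.

Lemma bij_linear_inverse (L : nzRingType) (A B : lmodType L)
    (f : {linear A -> B}) : bijective f ->
  exists g : {linear B -> A}, cancel f g /\ cancel g f.
Proof.
case=> g fK gK; have g_lin : linear g.
  by move=> c x y; apply: (can_inj fK); rewrite linearP !gK.
by exists (mk_linear g_lin).
Qed.

Lemma inj_surj_bij (A B : Type) (f : A -> B) : injective f -> surj f -> bijective f.
Proof.
move=> f_inj /choice[g fg]; exists g => // x; exact: f_inj.
Qed.

Section Submodules.
Variables (L : nzRingType) (X : lmodType L).

(** Submodules are arbitrary propositions on X, so that kernels, images and spans
    are all instances. *)
Record submod := Submod {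
  submod_pred :> X -> Prop;
  submod0 : submod_pred 0;
  submodP : forall c x y, submod_pred x -> submod_pred y ->
    submod_pred (c *: x + y) }.

Variable S : submod.

Definition submod_mem : {pred X} := fun x => `[< S x >].

Lemma submod_memP x : reflect (S x) (x \in submod_mem).
Proof. exact: asboolP. Qed.

Lemma submod_mem_closed : submod_closed submod_mem.
Proof.
split=> [|c x y /submod_memP Sx /submod_memP Sy]; apply/submod_memP.
  exact: submod0.
exact: submodP.
Qed.

HB.instance Definition _ :=
  GRing.isSubmodClosed.Build L X submod_mem submod_mem_closed.

Record submod_of := SubmodOf { submod_val :> X; _ : submod_val \in submod_mem }.
HB.instance Definition _ := [isSub for submod_val].
HB.instance Definition _ := [Choice of submod_of by <:].
HB.instance Definition _ := [SubChoice_isSubLmodule of submod_of by <:].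

Definition submod_mk x (Sx : S x) : submod_of :=
  SubmodOf (introT (submod_memP x) Sx).

Lemma submod_valP (x : submod_of) : S (submod_val x).
Proof. by apply/submod_memP; case: x. Qed.

Lemma submod_val_linear : linear submod_val.
Proof. by []. Qed.
Definition submod_incl : {linear submod_of -> X} := mk_linear submod_val_linear.

Lemma submodZ c x : S x -> S (c *: x).
Proof. by move=> Sx; rewrite -[_ *: _]addr0; apply: submodP => //; exact: submod0. Qed.
Lemma submodD x y : S x -> S y -> S (x + y).
Proof. by move=> Sx Sy; rewrite -[x]scale1r; apply: submodP. Qed.
Lemma submod_sum I r (P : pred I) F : (forall i, P i -> S (F i)) ->
  S (\sum_(i <- r | P i) F i).
Proof. by move=> SF; elim/big_ind: _ => //; [exact: submod0|exact: submodD]. Qed.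

Definition quot_mod : Type := Quotient.quot submod_mem.
HB.instance Definition _ := GRing.Zmodule.on quot_mod.

Definition quot_pi (x : X) : quot_mod := \pi_(Quotient.quot submod_mem)%qT x.

Lemma quot_piE x y : quot_pi x = quot_pi y <-> S (x - y).
Proof.
split=> [eq_xy|Sxy].
  by apply/submod_memP; rewrite Quotient.idealrBE; apply/eqP.
by apply/eqP; rewrite -Quotient.idealrBE; apply/submod_memP.
Qed.

Lemma quot_pi_surj : surj quot_pi.
Proof. by move=> y; exists (repr (y : Quotient.quot submod_mem)); exact: reprK. Qed.

Lemma quot_piD x y : quot_pi (x + y) = quot_pi x + quot_pi y.
Proof. exact: Quotient.pi_add. Qed.

Definition quot_scale c (y : quot_mod) : quot_mod :=
  quot_pi (c *: repr (y : Quotient.quot submod_mem)).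

Lemma quot_piZ c x : quot_scale c (quot_pi x) = quot_pi (c *: x).
Proof.
apply/quot_piE; rewrite -scalerBr; apply: submodZ; apply/quot_piE.
exact: (reprK (quot_pi x : Quotient.quot submod_mem)).
Qed.

Fact quot_scaleA a b y : quot_scale a (quot_scale b y) = quot_scale (a * b) y.
Proof. by have [x <-] := quot_pi_surj y; rewrite !quot_piZ scalerA. Qed.
Fact quot_scale1 : left_id 1 quot_scale.
Proof. by move=> y; have [x <-] := quot_pi_surj y; rewrite quot_piZ scale1r. Qed.
Fact quot_scaleDr : right_distributive quot_scale +%R.
Proof.
move=> c y z; have [x <-] := quot_pi_surj y; have [x' <-] := quot_pi_surj z.
by rewrite -quot_piD !quot_piZ scalerDr quot_piD.
Qed.
Fact quot_scaleDl y : {morph quot_scale^~ y : a b / a + b}.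
Proof.
by move=> a b; have [x <-] := quot_pi_surj y; rewrite !quot_piZ scalerDl quot_piD.
Qed.
HB.instance Definition _ := GRing.Zmodule_isLmodule.Build L quot_mod
  quot_scaleA quot_scale1 quot_scaleDr quot_scaleDl.

Fact quot_pi_linear : linear quot_pi.
Proof. by move=> c x y; rewrite quot_piD -quot_piZ. Qed.
Definition quot_proj : {linear X -> quot_mod} := mk_linear quot_pi_linear.

Lemma quot_proj0 x : quot_proj x = 0 <-> S x.
Proof.
rewrite -(linear0 quot_proj); split=> [/quot_piE|Sx]; first by rewrite subr0.
by apply/quot_piE; rewrite subr0.
Qed.
End Submodules.
Arguments submod_val {L X S} _.

Section Kernels.
Variables (L : nzRingType) (A B : lmodType L) (f : {linear A -> B}).

Fact ker_pred0 : f 0 = 0. Proof. exact: linear0. Qed.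
Fact ker_predP c x y : f x = 0 -> f y = 0 -> f (c *: x + y) = 0.
Proof. by move=> fx fy; rewrite linearP fx fy scaler0 addr0. Qed.
Definition ker_mod := Submod ker_pred0 ker_predP.

Lemma ker_incl_inj : injective (submod_incl ker_mod).
Proof. exact: val_inj. Qed.

Lemma ker_incl_exact : exact_at (submod_incl ker_mod) f.
Proof.
move=> y; split=> [fy|[x <-]]; last exact: (submod_valP x).
by exists (@submod_mk _ _ ker_mod y fy).
Qed.
End Kernels.

Section FiniteSums.
Variables (L : nzRingType).
Implicit Types (A B V W : lmodType L) (I J : finType).

Fact ffun_map_linear A B I (f : {linear A -> B}) :
  linear (fun u : {ffun I -> A} => [ffun i => f (u i)] : {ffun I -> B}).
Proof. by move=> c u w; apply/ffunP=> i; rewrite !ffunE linearP. Qed.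
Definition ffun_map A B I (f : {linear A -> B}) :
  {linear {ffun I -> A} -> {ffun I -> B}} := mk_linear (@ffun_map_linear A B I f).

Fact reindex_linear A I J (h : J -> I) :
  linear (fun u : {ffun I -> A} => [ffun j => u (h j)] : {ffun J -> A}).
Proof. by move=> c u w; apply/ffunP=> i; rewrite !ffunE. Qed.
Definition reindex_map A I J (h : J -> I) :
  {linear {ffun I -> A} -> {ffun J -> A}} := mk_linear (@reindex_linear A I J h).

Fact pair_map_linear A B W (f : {linear W -> A}) (g : {linear W -> B}) :
  linear (fun w : W => (f w, g w)).
Proof. by move=> c u w; rewrite !linearP. Qed.
Definition pair_map A B W (f : {linear W -> A}) (g : {linear W -> B}) :
  {linear W -> (A * B)%type} := mk_linear (pair_map_linear f g).

Fact sum_map_linear A B W (f : {linear A -> W}) (g : {linear B -> W}) :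
  linear (fun u : (A * B)%type => f u.1 + g u.2).
Proof.
by move=> c u w; rewrite /= !linearP scalerDr !addrA; congr (_ + _); rewrite addrAC.
Qed.
Definition sum_map A B W (f : {linear A -> W}) (g : {linear B -> W}) :
  {linear (A * B)%type -> W} := mk_linear (sum_map_linear f g).

Fact fst_linear A B : linear (fun u : (A * B)%type => u.1). Proof. by []. Qed.
Fact snd_linear A B : linear (fun u : (A * B)%type => u.2). Proof. by []. Qed.
Definition fst_map A B : {linear (A * B)%type -> A} := mk_linear (@fst_linear A B).
Definition snd_map A B : {linear (A * B)%type -> B} := mk_linear (@snd_linear A B).

Fact inl_linear A B : linear (fun x : A => (x, 0 : B)).
Proof. by move=> c u w; congr (_, _); rewrite /= scaler0 addr0. Qed.
Fact inr_linear A B : linear (fun x : B => (0 : A, x)).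
Proof. by move=> c u w; congr (_, _); rewrite /= scaler0 addr0. Qed.
Definition inl_map A B : {linear A -> (A * B)%type} := mk_linear (@inl_linear A B).
Definition inr_map A B : {linear B -> (A * B)%type} := mk_linear (@inr_linear A B).

Fact ev_linear A I (i : I) : linear (fun u : {ffun I -> A} => u i).
Proof. by move=> c u w; rewrite !ffunE. Qed.
Definition ev_map A I (i : I) : {linear {ffun I -> A} -> A} :=
  mk_linear (@ev_linear A I i).

Fact comb_linear A I (a : I -> A) :
  linear (fun u : {ffun I -> L^o} => \sum_i u i *: a i).
Proof.
move=> c u w; rewrite scaler_sumr -big_split; apply: eq_bigr => i _ /=.
by rewrite !ffunE scalerDl scalerA.
Qed.
Definition comb_map A I (a : I -> A) : {linear {ffun I -> L^o} -> A} :=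
  mk_linear (@comb_linear A I a).

Lemma comb_mapE A I (a : I -> A) u : comb_map a u = \sum_i u i *: a i.
Proof. by []. Qed.

Definition free_basis I (i : I) : {ffun I -> L^o} := [ffun j => (j == i)%:R].

Lemma free_basisE I (u : {ffun I -> L^o}) : u = \sum_i u i *: free_basis i.
Proof.
apply/ffunP=> j; rewrite sum_ffunE (bigD1 j) //= big1 ?addr0 => [|i ne_ij].
  by rewrite !ffunE eqxx [RHS]mulr1.
by rewrite !ffunE eq_sym (negPf ne_ij) scaler0.
Qed.

End FiniteSums.

Section Retracts.
Variables (L : nzRingType).
Implicit Types (A B V W P X Y : lmodType L) (I J : finType).

Definition retract W V : Prop :=
  exists (i : {linear W -> V}) (r : {linear V -> W}), cancel i r.

Lemma retract_trans A B W : retract A B -> retract B W -> retract A W.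
Proof.
case=> i [r ir] [i' [r' ir']]; exists (i' \o i : {linear _ -> _}).
by exists (r \o r' : {linear _ -> _}) => x /=; rewrite ir' ir.
Qed.

Lemma retract_ffun A B I : retract A B -> retract {ffun I -> A} {ffun I -> B}.
Proof.
case=> i [r ir]; exists (ffun_map I i), (ffun_map I r) => u.
by apply/ffunP=> j; rewrite !ffunE ir.
Qed.

Lemma retract_prod A B A' B' : retract A A' -> retract B B' ->
  retract (A * B)%type (A' * B')%type.
Proof.
case=> i [r ir] [i' [r' ir']].
exists (pair_map (i \o fst_map A B : {linear _ -> _})
                 (i' \o snd_map A B : {linear _ -> _})).
exists (pair_map (r \o fst_map A' B' : {linear _ -> _})
                 (r' \o snd_map A' B' : {linear _ -> _})).
by move=> [x y]; congr (_, _); [exact: ir|exact: ir'].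
Qed.

Lemma retract_reindex A I J (h : I -> J) : injective h ->
  retract {ffun I -> A} {ffun J -> A}.
Proof.
move=> h_inj; pose z (u : {ffun I -> A}) : {ffun J -> A} :=
  [ffun j => if [pick i | h i == j] is Some i then u i else 0].
have z_lin : linear z.
  by move=> c u w; apply/ffunP=> j; rewrite !ffunE; case: pickP => *;
    rewrite ?ffunE ?scaler0 ?addr0.
exists (mk_linear z_lin), (reindex_map A h) => u; apply/ffunP=> i.
rewrite !ffunE; case: pickP => [j /eqP/h_inj->//|/(_ i)]; by rewrite eqxx.
Qed.

Lemma retract_curry A I J :
  retract {ffun I -> {ffun J -> A}} {ffun (I * J)%type -> A}.
Proof.
pose f (u : {ffun I -> {ffun J -> A}}) : {ffun (I * J)%type -> A} :=
  [ffun ij => u ij.1 ij.2].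
pose g (u : {ffun (I * J)%type -> A}) : {ffun I -> {ffun J -> A}} :=
  [ffun i => [ffun j => u (i, j)]].
have f_lin : linear f by move=> c u w; apply/ffunP=> j; rewrite !ffunE.
have g_lin : linear g.
  by move=> c u w; apply/ffunP=> j; apply/ffunP=> i; rewrite !ffunE.
exists (mk_linear f_lin), (mk_linear g_lin) => u.
by apply/ffunP=> i; apply/ffunP=> j; rewrite !ffunE.
Qed.

Lemma retract_sum A I J :
  retract ({ffun I -> A} * {ffun J -> A})%type {ffun (I + J)%type -> A}.
Proof.
pose f (u : ({ffun I -> A} * {ffun J -> A})%type) : {ffun (I + J)%type -> A} :=
  [ffun ij => match ij with inl i => u.1 i | inr j => u.2 j end].
have f_lin : linear f by move=> c u w; apply/ffunP=> [[i|j]]; rewrite !ffunE.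
exists (mk_linear f_lin).
exists (pair_map (reindex_map A (@inl I J)) (reindex_map A (@inr I J))).
by move=> [u w]; congr (_, _); apply/ffunP=> i; rewrite !ffunE.
Qed.

(** A retract of [V^d] is a direct summand, a complement being the kernel of
    the retraction. *)
Lemma in_addP V W :
  in_add V W <-> exists I : finType, retract W {ffun I -> V}.
Proof.
split=> [[d [W' [f /bij_linear_inverse[g [fK gK]]]]]|[I WI]].
  exists 'I_d, (f \o inl_map W W' : {linear _ -> _}).
  by exists (fst_map W W' \o g : {linear _ -> _}) => w /=; rewrite fK.
have [i [r ir]] : retract W {ffun 'I_#|I| -> V}.
  exact: (retract_trans WI (retract_reindex _ enum_rank_inj)).
pose s := sum_map i (submod_incl (ker_mod r)).
exists #|I|, (submod_of (ker_mod r)), s.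
have sE w x : s (w, x) = i w + submod_val x by [].
have rk u : r (u - i (r u)) = 0 by rewrite linearB ir subrr.
exists (fun u => (r u, @submod_mk _ _ (ker_mod r) _ (rk u))) => [[w x]|u].
  have rx : r (submod_val x) = 0 := submod_valP x.
  have rE : r (s (w, x)) = w by rewrite sE linearD ir /= rx addr0.
  congr (_, _) => //; apply: val_inj.
  by rewrite /= rE addrC addKr.
by rewrite /= addrC subrK.
Qed.

Lemma in_add_retract V V' W : retract W V' -> in_add V V' -> in_add V W.
Proof.
move=> WV' /in_addP[I V'V]; apply/in_addP; exists I; exact: retract_trans V'V.
Qed.

Lemma in_add_refl V : in_add V V.
Proof.
apply/in_addP; exists 'I_1.
have d_lin : linear (fun x : V => [ffun _ : 'I_1 => x] : {ffun 'I_1 -> V}).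
  by move=> c x y; apply/ffunP=> i; rewrite !ffunE.
by exists (mk_linear d_lin), (ev_map V ord0) => x; rewrite /= ffunE.
Qed.

Lemma in_add_ffun V W I : in_add V W -> in_add V {ffun I -> W}.
Proof.
move=> /in_addP[J WJ]; apply/in_addP; exists (I * J)%type.
exact: retract_trans (retract_ffun I WJ) (retract_curry _ _ _).
Qed.

Lemma in_add_trans V W A : in_add V W -> in_add W A -> in_add V A.
Proof.
by move=> VW /in_addP[I AI]; apply: in_add_retract AI (in_add_ffun _ VW).
Qed.

Lemma in_add_prod V A B : in_add V A -> in_add V B -> in_add V (A * B)%type.
Proof.
move=> /in_addP[I AI] /in_addP[J BJ]; apply/in_addP; exists (I + J)%type.
exact: retract_trans (retract_prod AI BJ) (retract_sum _ _ _).
Qed.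

Lemma in_add_fst A B : in_add (A * B)%type A.
Proof. by apply: in_add_retract (in_add_refl _); exists (inl_map A B), (fst_map A B). Qed.

Lemma in_add_snd A B : in_add (A * B)%type B.
Proof. by apply: in_add_retract (in_add_refl _); exists (inr_map A B), (snd_map A B). Qed.

Lemma in_add_projective P : in_add L^o P -> projective P.
Proof.
move=> /in_addP[I [i [r ir]]] A B g f g_surj.
have [a ga] := fin_all_exists (fun j : I => g_surj (f (r (free_basis L j)))).
exists (comb_map a \o i : {linear _ -> _}) => x.
rewrite -[in RHS](ir x) [in RHS](free_basisE (i x)) [in LHS]/= !linear_sum.
by apply: eq_bigr => j _; rewrite !linearZ ga.
Qed.

Lemma fin_gen_surj A B (f : {linear A -> B}) : surj f -> fin_gen A -> fin_gen B.
Proof.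
move=> f_surj [d [g gP]]; exists d, (f \o g) => y; have [x <-] := f_surj y.
have [c ->] := gP x; exists c; rewrite linear_sum.
by apply: eq_bigr => j _; rewrite linearZ.
Qed.

Lemma fin_gen_free I : fin_gen {ffun I -> L^o}.
Proof.
exists #|I|, (fun j => free_basis L (enum_val j)) => u.
exists (fun j => u (enum_val j)); rewrite [LHS]free_basisE.
by rewrite (reindex _ (onW_bij _ (@enum_val_bij I))).
Qed.

Lemma fin_genP A : fin_gen A <->
  exists (I : finType) (f : {linear {ffun I -> L^o} -> A}), surj f.
Proof.
split=> [[d [g gP]]|[I [f f_surj]]].
  exists 'I_d, (comb_map g) => x; have [c ->] := gP x.
  by exists [ffun i => c i]; rewrite comb_mapE; apply: eq_bigr => i _; rewrite ffunE.
exact: fin_gen_surj f_surj (fin_gen_free I).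
Qed.

Lemma fin_gen_prod A B : fin_gen A -> fin_gen B -> fin_gen (A * B)%type.
Proof.
move=> /fin_genP[I [f f_surj]] /fin_genP[J [g g_surj]]; apply/fin_genP.
exists (I + J)%type.
exists (pair_map (f \o reindex_map L^o (@inl I J) : {linear _ -> _})
                 (g \o reindex_map L^o (@inr I J) : {linear _ -> _})) => -[x y].
have [u <-] := f_surj x; have [w <-] := g_surj y.
exists [ffun ij => match ij with inl i => u i | inr j => w j end].
by congr (_, _) => /=; congr (_ _); apply/ffunP=> i; rewrite !ffunE.
Qed.
End Retracts.

Section AddResolutions.
Variables (L : nzRingType) (V : lmodType L).
Implicit Types (X Y B : lmodType L).

Lemma add_resolution_iso m X Y (f : {linear X -> Y}) : bijective f ->
  add_resolution V m X -> add_resolution V m Y.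
Proof.
move=> f_bij [W [d [e [WV W0 dd de e_surj]]]]; have [g fK gK] := f_bij.
exists W, d, (f \o e : {linear _ -> _}); split=> // [w|y] /=.
  by rewrite -de -(linear0 f); split=> [/(can_inj fK)|->//].
by have [x ex] := e_surj (g y); exists x; rewrite ex gK.
Qed.

Lemma add_resolution0 X : in_add V X -> add_resolution V 0 X.
Proof.
move=> VX; pose Z : lmodType L := {ffun 'I_0 -> X}.
have Z0 (z : Z) : z = 0 by apply/ffunP=> -[].
exists (fun i => if i is 0%N then X else Z), (fun=> \0), idfun.
split=> [[]|[]|i y|y|x] //.
- by split=> // _; exists 0; rewrite linear0 (Z0 y).
- by split=> [y0|[x <-]] //; exists 0; rewrite -[y]/(idfun y) y0.
- by exists x.
Qed.

(** Splicing at the kernel of the augmentation. *)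
Lemma add_resolutionS m B Y (p : {linear B -> Y}) : in_add V B -> surj p ->
  add_resolution V m (submod_of (ker_mod p)) -> add_resolution V m.+1 Y.
Proof.
move=> VB p_surj [W [d [e [WV W0 dd de e_surj]]]].
pose W' i := if i is i'.+1 then W i' else B.
pose d' : forall i, {linear W' i.+1 -> W' i} := fun i =>
  if i is i'.+1 then d i' else (submod_incl (ker_mod p) \o e : {linear _ -> _}).
exists W', d', p; split=> [[|i]|[|i]|[|i]|y|] //=; first exact: WV.
- exact: W0.
- move=> y; rewrite -de; split=> [ey0|ey0]; first exact: val_inj.
  by rewrite /= ey0.
- rewrite (ker_incl_exact p y); split=> [[x <-]|[w <-]]; last by exists (e w).
  by have [w <-] := e_surj x; exists w.
Qed.
End AddResolutions.

(** * Filtrations and resolutions *)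

Definition noetherian (L : nzRingType) : Prop :=
  forall (X : lmodType L) (S : submod X), fin_gen X -> fin_gen (submod_of S).

Section Filtrations.
Variables (L : nzRingType) (L_noeth : noetherian L).
Implicit Types (X Y P : lmodType L).

(** Bundling a module with its finite generation lets a cover be chosen for it,
    and the syzygies of a module be obtained by iteration. *)
Record fg_module := FgModule { fg_sort :> lmodType L; fg_fin : fin_gen fg_sort }.

Definition cover_ix (M : fg_module) : finType :=
  projT1 (cid (iffLR (fin_genP M) (fg_fin M))).
Definition cover (M : fg_module) : {linear {ffun cover_ix M -> L^o} -> M} :=
  projT1 (cid (projT2 (cid (iffLR (fin_genP M) (fg_fin M))))).
Lemma cover_surj (M : fg_module) : surj (cover M).
Proof. exact: (projT2 (cid (projT2 (cid (iffLR (fin_genP M) (fg_fin M)))))). Qed.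

Definition next_syzygy (M : fg_module) : fg_module :=
  FgModule (L_noeth (ker_mod (cover M)) (fin_gen_free L (cover_ix M))).

Variable M : fg_module.

Definition Omega a : fg_module := iter a next_syzygy M.

(** Y has a filtration with j layers that are finite sums of copies of Omega a.
    The recursion peels off the bottom layer: this is the side on which the
    next syzygy of the quotient yields a resolution. *)
Fixpoint filtered a j Y : Prop :=
  if j is j'.+1 then
    exists (I : finType) (Y' : lmodType L)
      (i : {linear {ffun I -> Omega a} -> Y}) (q : {linear Y -> Y'}),
      [/\ injective i, surj q, exact_at i q & filtered a j' Y']
  else forall y : Y, y = 0.

(** The horseshoe lemma: covers of the bottom layer and of the quotient add up to
    a cover of Y, whose kernel is an extension of the two kernels. *)
Lemma filtered_syzygy a j Y : filtered a j Y ->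
  exists P (p : {linear P -> Y}),
    [/\ in_add L^o P, surj p & filtered a.+1 j (submod_of (ker_mod p))].
Proof.
elim: j Y => [|j IHj] Y /= => [Y0|[I [Y' [i [q [i_inj q_surj iq fY']]]]]].
  exists {ffun 'I_0 -> L^o}, \0; split=> [|y|y].
  - exact: in_add_ffun (in_add_refl _).
  - by exists 0; rewrite (Y0 y).
  by apply: val_inj; apply/ffunP=> -[].
have [P' [p' [addP' p'_surj fK']]] := IHj Y' fY'.
have [h hE] := in_add_projective addP' p' q_surj.
(* c covers the bottom layer; h lifts the cover p' of the quotient to Y. *)
pose c : {linear {ffun I -> {ffun cover_ix (Omega a) -> L^o}} -> Y} :=
  i \o ffun_map I (cover (Omega a)).
pose p := sum_map c h.
have pE u w : p (u, w) = c u + h w by [].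
have qc u : q (c u) = 0 by apply/iq; exists (ffun_map I (cover (Omega a)) u).
have im_c y : q y = 0 -> exists u, c u = y.
  case/iq=> s <-; have [u uE] := fin_all_exists (fun j => cover_surj (s j)).
  by exists (finfun u); congr (i _); apply/ffunP=> l; rewrite !ffunE uE.
exists ({ffun I -> {ffun cover_ix (Omega a) -> L^o}} * P')%type, p; split.
- by apply: in_add_prod addP'; do 2!apply: in_add_ffun; exact: in_add_refl.
- move=> y; have [w wE] := p'_surj (q y).
  have [|u uE] := im_c (y - h w); first by rewrite linearB hE wE subrr.
  by exists (u, w); rewrite pE uE subrK.
have in_ker (z : submod_of (ker_mod p)) : p' (submod_val z).2 = 0.
  have := submod_valP z; case: (submod_val z) => u w /= /(congr1 q).
  by rewrite linearD qc add0r hE linear0.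
pose q1 (z : submod_of (ker_mod p)) : submod_of (ker_mod p') :=
  @submod_mk _ _ (ker_mod p') _ (in_ker z).
have q1_lin : linear q1 by move=> b y z; apply: val_inj.
have in_ker' (s : {ffun I -> Omega a.+1}) :
    p ([ffun l => submod_val (s l)], 0) = 0.
  rewrite pE linear0 addr0 -(linear0 i); congr (i _); apply/ffunP=> l.
  by rewrite !ffunE (submod_valP (s l)).
pose i1 (s : {ffun I -> Omega a.+1}) : submod_of (ker_mod p) :=
  @submod_mk _ _ (ker_mod p) _ (in_ker' s).
have i1_lin : linear i1.
  move=> b s t; apply: val_inj; congr (_, _); last by rewrite /= scaler0 addr0.
  by apply/ffunP=> l; rewrite !ffunE.
exists I, (submod_of (ker_mod p')), (mk_linear i1_lin), (mk_linear q1_lin).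
split=> [s t|z|z|//].
- move/(congr1 (fun z : submod_of _ => (submod_val z).1)) => /ffunP st.
  by apply/ffunP=> l; apply: val_inj; have := st l; rewrite !ffunE.
- have [|u uE] := im_c (h (submod_val z)).
    by rewrite hE; exact: (submod_valP z).
  have uz : p (- u, submod_val z) = 0 by rewrite pE linearN uE addNr.
  by exists (@submod_mk _ _ (ker_mod p) _ uz); apply: val_inj.
split=> [z0|[s <-]]; last exact: val_inj.
have z2 : (submod_val z).2 = 0.
  exact: (congr1 (fun t : submod_of (ker_mod p') => submod_val t) z0).
have cu l : cover (Omega a) ((submod_val z).1 l) = 0.
  have /i_inj/ffunP/(_ l) : i (ffun_map I (cover (Omega a)) (submod_val z).1) = i 0.
    have : p (submod_val z) = 0 by exact: (submod_valP z).
    by rewrite [submod_val z]surjective_pairing pE z2 !linear0 addr0.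
  by rewrite !ffunE.
exists [ffun l => @submod_mk _ _ (ker_mod (cover (Omega a))) _ (cu l)].
apply: val_inj; rewrite [RHS]surjective_pairing /= z2; congr (_, _).
by apply/ffunP=> l; rewrite !ffunE.
Qed.

(** With A the bottom layer, Y' the quotient and P -> Y' a cover lifted to Y, the map
    A x P -> Y is onto and its kernel is the kernel of P -> Y', again filtered. *)
Lemma filtered_resolution (U : lmodType L) a j Y :
    in_add U L^o -> (forall i, (i <= j)%N -> in_add U (Omega (a + i))) ->
  filtered a j.+1 Y -> add_resolution U j Y.
Proof.
move=> UL; elim: j a Y => [|j IHj] a Y UOm.
  case=> I [Y' [i [q [i_inj q_surj iq Y'0]]]].
  apply: add_resolution0; apply: in_add_retract (in_add_ffun I (UOm 0%N (leqnn 0))).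
  rewrite addn0.
  have i_bij : bijective i by apply: inj_surj_bij => // y; apply/iq; exact: Y'0.
  by have [g [_ gK]] := bij_linear_inverse i_bij; exists g, i.
case=> I [Y' [i [q [i_inj q_surj iq fY']]]].
have [P [p [addP p_surj fK]]] := @filtered_syzygy a j.+1 Y' fY'.
have [h hE] := in_add_projective addP p q_surj.
pose r := sum_map i h.
have rE u w : r (u, w) = i u + h w by [].
have qi s : q (i s) = 0 by apply/iq; exists s.
have addB : in_add U ({ffun I -> Omega a} * P)%type.
  apply: in_add_prod (in_add_trans UL addP).
  by apply: in_add_ffun; rewrite -[a]addn0; exact: UOm.
apply: (add_resolutionS (p := r)) => // [y|].
  have [w wE] := p_surj (q y).
  have /iq[s sE] : q (y - h w) = 0 by rewrite linearB hE wE subrr.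
  by exists (s, w); rewrite rE sE subrK.
have : add_resolution U j (submod_of (ker_mod p)).
  by apply: IHj fK => l le_lj; rewrite addSnnS; exact: UOm.
have in_ker (z : submod_of (ker_mod r)) : p (submod_val z).2 = 0.
  have /(congr1 q) : r (submod_val z) = 0 by exact: (submod_valP z).
  by rewrite [submod_val z]surjective_pairing rE linearD qi add0r hE linear0.
pose f (z : submod_of (ker_mod r)) : submod_of (ker_mod p) :=
  @submod_mk _ _ (ker_mod p) _ (in_ker z).
have f_lin : linear f by move=> b y z; apply: val_inj.
suff f_bij : bijective (mk_linear f_lin).
  have [g [fK' gK]] := bij_linear_inverse f_bij.
  by apply: (add_resolution_iso (f := g)); exists (mk_linear f_lin).
apply: inj_surj_bij => [y z eq_yz|z].
  have eq2 : (submod_val y).2 = (submod_val z).2.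
    exact: (congr1 (fun t : submod_of (ker_mod p) => submod_val t) eq_yz).
  have ry : r (submod_val y) = 0 := submod_valP y.
  have rz : r (submod_val z) = 0 := submod_valP z.
  apply: val_inj; rewrite [LHS]surjective_pairing [RHS]surjective_pairing /= eq2.
  congr (_, _); apply/i_inj/(addIr (h (submod_val z).2)).
  by rewrite -rE -{1}eq2 -rE -!surjective_pairing ry rz.
have /iq[s sE] : q (h (submod_val z)) = 0 by rewrite hE; exact: (submod_valP z).
have rz : r (- s, submod_val z) = 0 by rewrite rE linearN sE addNr.
by exists (@submod_mk _ _ (ker_mod r) _ rz); apply: val_inj.
Qed.
End Filtrations.

(** * Finite generation and minimal generators *)

(** A generating family of least size: no coefficient of a relation between its
    members is invertible, since the corresponding member could be dropped. *)
Lemma minimal_generators (R : nzRingType) (X : lmodType R) : fin_gen X ->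
  exists d (g : 'I_d -> X),
    (forall x, exists c : 'I_d -> R, x = \sum_i c i *: g i) /\
    forall c : 'I_d -> R, \sum_i c i *: g i = 0 -> forall i u, u * c i != 1.
Proof.
pose gen d (g : 'I_d -> X) := forall x, exists c : 'I_d -> R, x = \sum_i c i *: g i.
move=> X_fg; have ex_d : exists d, `[< exists g, @gen d g >].
  by have [d dP] := X_fg; exists d; apply/asboolP.
case: (ex_minnP ex_d) => d /asboolP[g gP] min_d; exists d, g; split=> // c c0 i u.
apply/eqP=> uc1; case: d g gP c c0 i min_d uc1 => [|d] g gP c c0 i min_d uc1.
  by case: i uc1.
have /min_d : `[< exists g, @gen d g >]; last by rewrite ltnn.
have gi : g i = \sum_(j < d) (- (u * c (lift i j))) *: g (lift i j).
  have := congr1 ( *:%R u) c0; rewrite scaler0 (bigD1_ord i) //= scalerDr.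
  rewrite scalerA uc1 scale1r scaler_sumr => /eqP; rewrite addr_eq0 => /eqP->.
  by rewrite -sumrN; apply: eq_bigr => j _; rewrite scaleNr scalerA.
apply/asboolP; exists (g \o lift i) => x; have [b ->] := gP x.
exists (fun j => b (lift i j) - b i * (u * c (lift i j))).
rewrite (bigD1_ord i) //= gi scaler_sumr -big_split; apply: eq_bigr => j _ /=.
by rewrite scalerA mulrN -scalerDl addrC.
Qed.

Lemma fin_gen_sum (R : nzRingType) (X : lmodType R) (I : finType) (g : I -> X) :
  (forall x, exists c : I -> R, x = \sum_i c i *: g i) -> fin_gen X.
Proof.
move=> gP; apply/fin_genP; exists I, (comb_map g) => x; have [c ->] := gP x.
by exists (finfun c); rewrite comb_mapE; apply: eq_bigr => i _; rewrite ffunE.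
Qed.

(** The coordinate vectors of the members of a subspace form a row space: it is
    that of a matrix of largest rank among those with rows of this kind. *)
Lemma field_noetherian (k : fieldType) : noetherian k.
Proof.
move=> X S [d [g gP]]; pose v (c : 'rV[k]_d) := \sum_i c 0 i *: g i.
have vD b c : v (b + c) = v b + v c.
  by rewrite -big_split; apply: eq_bigr => i _; rewrite mxE scalerDl.
have vM m (D : 'rV_m) (A : 'M_(m, d)) : (forall i, S (v (row i A))) -> S (v (D *m A)).
  move=> SA; have -> : v (D *m A) = \sum_j D 0 j *: v (row j A).
    under [RHS]eq_bigr do rewrite scaler_sumr.
    rewrite exchange_big; apply: eq_bigr => i _ /=; rewrite mxE scaler_suml.
    by apply: eq_bigr => j _; rewrite scalerA mxE.
  by apply: submod_sum => j _; apply: submodZ.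
pose P (r : nat) := `[< exists2 A : 'M[k]_d, forall i, S (v (row i A)) & \rank A = r >].
have exP : exists r, P r.
  exists 0%N; apply/asboolP; exists 0; last exact: mxrank0.
  move=> i; rewrite /v big1 => [|j _]; first exact: submod0.
  by rewrite !mxE scale0r.
have [|r /asboolP[A SA rA] max_r] := @ex_maxnP _ d exP.
  by move=> r /asboolP[A _ <-]; exact: rank_leq_row.
apply: (@fin_gen_sum _ _ 'I_d (fun i => submod_mk (SA i))) => x.
have [c0 xE] := gP (submod_val x); pose c : 'rV_d := \row_i c0 i.
have vc : v c = submod_val x by rewrite xE; apply: eq_bigr => i _; rewrite mxE.
have /submxP[D cE] : (c <= A)%MS.
  have SB i : S (v (row i <<(A + c)%MS>>%MS)).
    have : (row i <<(A + c)%MS>>%MS <= A + c)%MS.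
      by rewrite (submx_trans (row_sub _ _)) ?genmxE.
    case/sub_addsmxP=> -[u1 u2] ->; rewrite vD; apply: submodD; apply: vM => // j.
    by rewrite row_id vc; exact: submod_valP.
  have /max_r le_r : P (\rank <<(A + c)%MS>>%MS).
    by apply/asboolP; exists <<(A + c)%MS>>%MS.
  apply: submx_trans (addsmxSr A c) _.
  have [le_A eq_A] := mxrank_leqif_sup (addsmxSl A c).
  by rewrite -eq_A eqn_leq le_A rA -(mxrank_gen (A + c)%MS) le_r.
exists (fun i => D 0 i); apply: val_inj; rewrite /= -vc cE.
have incl_sum := linear_sum (submod_incl S); rewrite [RHS]incl_sum.
rewrite /v; under eq_bigr do rewrite mxE scaler_suml.
rewrite exchange_big; apply: eq_bigr => j _ /=; rewrite scaler_sumr.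
by apply: eq_bigr => i _; rewrite scalerA mxE.
Qed.

(** * The exterior algebra as a local ring *)

Section ExteriorModules.
Variables (k : fieldType) (n : nat).
Local Notation L := (exterior k n).
Implicit Types (S T U : {set 'I_n}) (x y : L) (a b : k).

Lemma ext_algl a x : a%:A * x = a *: x.
Proof. by rewrite -scalerAl mul1r. Qed.

Lemma ext_algr a x : x * a%:A = a *: x.
Proof. by rewrite -scalerAr mulr1. Qed.

Section Restriction.
Variable X : lmodType L.

(** A copy of X, to carry its structure of vector space over k. *)
Definition restr : Type := X.
HB.instance Definition _ := GRing.Zmodule.on restr.
Definition restr_scale (a : k) (u : restr) : restr := (a%:A : L) *: (u : X).

Fact restr_scaleA a b u : restr_scale a (restr_scale b u) = restr_scale (a * b) u.
Proof. by rewrite /restr_scale scalerA ext_algl scalerA. Qed.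
Fact restr_scale1 : left_id 1 restr_scale.
Proof. by move=> u; rewrite /restr_scale !scale1r. Qed.
Fact restr_scaleDr : right_distributive restr_scale +%R.
Proof. by move=> a u w; rewrite /restr_scale scalerDr. Qed.
Fact restr_scaleDl u : {morph restr_scale^~ u : a b / a + b}.
Proof. by move=> a b; rewrite /restr_scale !scalerDl. Qed.
HB.instance Definition _ := GRing.Zmodule_isLmodule.Build k restr
  restr_scaleA restr_scale1 restr_scaleDr restr_scaleDl.

Lemma restr_scaleE a (u : restr) : a *: u = (a%:A : L) *: (u : X).
Proof. by []. Qed.

Lemma fin_gen_restr : fin_gen X <-> fin_gen restr.
Proof.
split=> [[d [g gP]]|[d [g gP]]].
  apply: (@fin_gen_sum _ restr ('I_d * {set 'I_n})%type
    (fun p => (ext_base k p.2 : L) *: (g p.1) : X)) => u.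
  have [c ->] := gP u; exists (fun p => c p.1 p.2).
  rewrite -(pair_bigA _ (fun i S => c i S *: ((ext_base k S *: g i : X) : restr))) /=.
  apply: eq_bigr => i _; rewrite [in LHS](ext_baseE (c i)) scaler_suml.
  by apply: eq_bigr => S _; rewrite restr_scaleE scalerA ext_algl.
apply: (@fin_gen_sum _ X 'I_d g) => u; have [c ->] := gP u.
by exists (fun i => (c i)%:A).
Qed.
End Restriction.

Lemma exterior_noetherian : noetherian L.
Proof.
move=> X S /fin_gen_restr X_fg.
have Sk a (u v : restr X) : S u -> S v -> S (a *: u + v).
  by move=> Su Sv; rewrite restr_scaleE; apply: submodP.
pose Sr := @Submod k (restr X) S (submod0 S) Sk.
have [d [g gP]] := field_noetherian Sr X_fg.
have Sg i : S (submod_val (g i)) := submod_valP (g i).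
apply: (@fin_gen_sum _ _ 'I_d (fun i => submod_mk (Sg i))) => x.
have Sx := submod_valP x.
have [c /(congr1 submod_val) cE] := gP (@submod_mk _ _ Sr _ Sx).
exists (fun i => (c i)%:A); apply: val_inj; rewrite [LHS]cE.
rewrite [LHS](linear_sum (submod_incl Sr)) [RHS](linear_sum (submod_incl S)).
by apply: eq_bigr.
Qed.

(** Membership in the s-th power of the radical, by supports. *)
Definition deg_ge s x : Prop := forall S, (#|S| < s)%N -> x S = 0.

Lemma ext_coefM x y U :
  (x * y) U = \sum_S \sum_T (ext_sign k S T * (x S * y T)) * (U == S :|: T)%:R.
Proof.
rewrite ext_mulE /ext_mul sum_ffunE; apply: eq_bigr => S _.
by rewrite sum_ffunE; apply: eq_bigr => T _; rewrite !ffunE.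
Qed.

Lemma deg_geM s t x y : deg_ge s x -> deg_ge t y -> deg_ge (s + t) (x * y).
Proof.
move=> sx ty U ltU; rewrite ext_coefM big1 // => S _; rewrite big1 // => T _.
rewrite /ext_sign; case: ifP => [dST|]; last by rewrite !mul0r.
have [eU|] := eqVneq; last by rewrite mulr0.
have [/sx->|le_s] := ltnP #|S| s; first by rewrite !(mul0r, mulr0).
have [/ty->|le_t] := ltnP #|T| t; first by rewrite !(mul0r, mulr0).
move: ltU; rewrite eU cardsU ltnNge; have /eqP-> := etrans (setI_eq0 S T) dST.
by rewrite cards0 subn0 leq_add.
Qed.

Lemma deg_ge0 x : deg_ge 0 x. Proof. by []. Qed.

Lemma deg_geD s x y : deg_ge s x -> deg_ge s y -> deg_ge s (x + y).
Proof. by move=> sx sy S lt; rewrite ffunE sx // sy // addr0. Qed.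

Lemma deg_ge_sum (I : finType) (P : pred I) s (F : I -> L) :
  (forall i, P i -> deg_ge s (F i)) -> deg_ge s (\sum_(i | P i) F i).
Proof.
move=> sF; apply: (big_ind (deg_ge s)) => //; first by move=> S _; rewrite ffunE.
exact: deg_geD.
Qed.

Lemma deg_ge_max x : deg_ge n.+1 x -> x = 0.
Proof.
move=> nx; apply/ffunP=> S; rewrite nx ?ffunE // ltnS -[n in (_ <= n)%N]card_ord.
exact: max_card.
Qed.

Lemma deg_ge1 x : deg_ge 1 x <-> x set0 = 0.
Proof.
split=> [->//|x0 S]; first by rewrite cards0.
by rewrite ltnS leqn0 cards_eq0 => /eqP->.
Qed.

Lemma deg_ge_base S : deg_ge #|S| (ext_base k S).
Proof. by move=> T lt; rewrite ffunE; case: eqP lt => // ->; rewrite ltnn. Qed.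

Lemma ext_coef0M x y : (x * y) set0 = x set0 * y set0.
Proof.
rewrite ext_coefM (bigD1 set0) //= (bigD1 set0) //= [X in _ + X + _]big1 => [|T nT].
  rewrite [X in _ + X]big1 ?addr0 => [|S nS].
    by rewrite ext_sign0l setU0 eqxx mul1r mulr1.
  by rewrite big1 // => T _; rewrite eq_sym setU_eq0 (negPf nS) mulr0.
by rewrite set0U eq_sym (negPf nT) mulr0.
Qed.

(** An element with nonzero constant term is a scalar minus a nilpotent, whence
    the geometric series. *)
Lemma ext_left_inverse x : x set0 != 0 -> exists u, u * x = 1.
Proof.
move=> x0; pose r := 1 - (x set0)^-1 *: x.
have deg_r : deg_ge 1 r.
  by apply/deg_ge1; rewrite !ffunE eqxx /GRing.scale /= mulVf // subrr.
have rX m : deg_ge m (r ^+ m).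
  elim: m => [|m IHm]; first exact: deg_ge0.
  by rewrite exprS -add1n; exact: deg_geM deg_r IHm.
have rn : r ^+ n.+1 = 0 := deg_ge_max (rX n.+1).
pose q := \sum_(i < n.+1) r ^+ i.
have qr : q * (1 - r) = 1.
  have cqr : GRing.comm q (1 - r).
    apply: commrB; first exact: commr1.
    by apply: commr_sym; apply: commr_sum => i _; exact: commrX.
  have := subrX1 r n.+1; rewrite rn sub0r -/q => /(congr1 -%R).
  by rewrite opprK -mulNr opprB -cqr; exact: esym.
exists ((x set0)^-1 *: q); rewrite -scalerAl scalerAr.
by have <- : 1 - r = (x set0)^-1 *: x by rewrite /r opprB addrC subrK.
Qed.

(** The simple module: the field, on which L acts by constant terms. *)
Definition triv : Type := k.
HB.instance Definition _ := GRing.Zmodule.on triv.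
Definition triv_scale x (a : triv) : triv := x set0 * a.
Fact triv_scaleA x y a : triv_scale x (triv_scale y a) = triv_scale (x * y) a.
Proof. by rewrite /triv_scale ext_coef0M mulrA. Qed.
Fact triv_scale1 : left_id 1 triv_scale.
Proof. by move=> a; rewrite /triv_scale ffunE eqxx mul1r. Qed.
Fact triv_scaleDr : right_distributive triv_scale +%R.
Proof. by move=> x a b; rewrite /triv_scale mulrDr. Qed.
Fact triv_scaleDl a : {morph triv_scale^~ a : x y / x + y}.
Proof. by move=> x y; rewrite /triv_scale ffunE mulrDl. Qed.
HB.instance Definition _ := GRing.Zmodule_isLmodule.Build L triv
  triv_scaleA triv_scale1 triv_scaleDr triv_scaleDl.

Lemma triv_scaleE x (a : triv) : x *: a = x set0 * a :> k.
Proof. by []. Qed.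

Lemma coef0_alg a : (a%:A : L) set0 = a.
Proof. by rewrite !ffunE eqxx /GRing.scale /= mulr1. Qed.

Lemma fin_gen_triv : fin_gen triv.
Proof.
apply: (@fin_gen_sum _ triv 'I_1 (fun _ => 1 : k)) => a.
by exists (fun _ => a%:A); rewrite big_ord1 triv_scaleE coef0_alg mulr1.
Qed.

Section Modules.
Variable X : lmodType L.
Implicit Types u w : X.

(** Minimal generators of a module over the local ring L are independent modulo
    the radical. *)
Lemma local_generators : fin_gen X ->
  exists d (g : 'I_d -> X),
    (forall u, exists c : 'I_d -> L, u = \sum_i c i *: g i) /\
    forall c : 'I_d -> L, \sum_i c i *: g i = 0 -> forall i, deg_ge 1 (c i).
Proof.
case/minimal_generators=> d [g [gP gmin]]; exists d, g; split=> // c c0 i.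
apply/deg_ge1/eqP; apply: contraT => /ext_left_inverse[u uc].
by have := gmin c c0 i u; rewrite uc eqxx.
Qed.

(** The e_S with #|S| >= j span the j-th power of the radical. *)
Definition annihilated j : Prop :=
  forall S, (j <= #|S|)%N -> forall u, (ext_base k S : L) *: u = 0.

Lemma annihilatedE j x u : annihilated j -> deg_ge j x -> x *: u = 0.
Proof.
move=> Xj jx; rewrite (ext_baseE x) scaler_suml big1 // => S _.
have [/jx->|le_j] := ltnP #|S| j; first by rewrite !scale0r.
by rewrite -ext_algl -scalerA Xj // scaler0.
Qed.

Lemma semisimple_triv : fin_gen X -> annihilated 1 ->
  exists d (i : {linear {ffun 'I_d -> triv} -> X}), bijective i.
Proof.
move=> /local_generators[d [g [gP gmin]]] X1; exists d.
have scale0 x u : x *: u = (x set0)%:A *: u.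
  apply/eqP; rewrite -subr_eq0 -scalerBl; apply/eqP; apply: annihilatedE X1 _.
  by apply/deg_ge1; rewrite !ffunE eqxx /GRing.scale /= mulr1 subrr.
pose i (s : {ffun 'I_d -> triv}) : X := \sum_j ((s j : k)%:A : L) *: g j.
have i_lin : linear i.
  move=> x s t; rewrite scaler_sumr -big_split; apply: eq_bigr => j _ /=.
  rewrite !ffunE triv_scaleE scalerDl scalerDl scalerA [(x * _) *: _]scale0.
  by rewrite ext_coef0M coef0_alg.
exists (mk_linear i_lin); apply: inj_surj_bij => [s t st|u].
  apply/ffunP=> j; apply/eqP; rewrite -subr_eq0; apply/eqP.
  have : i (s - t) = 0.
    have iB := linearB (mk_linear i_lin) s t; rewrite [LHS]iB.
    by apply/eqP; rewrite subr_eq0; apply/eqP.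
  by move/gmin/(_ j)/deg_ge1; rewrite coef0_alg !ffunE.
have [c ->] := gP u; exists [ffun j => (c j) set0].
by apply: eq_bigr => j _; rewrite ffunE -scale0.
Qed.
End Modules.

Definition triv_module : fg_module L := FgModule fin_gen_triv.

(** The bottom layer is the j-th power of the radical applied to X; the next power
    being 0 on X, this layer is semisimple. *)
Lemma annihilated_filtered j (X : lmodType L) : fin_gen X -> annihilated X j ->
  filtered exterior_noetherian triv_module 0 j X.
Proof.
elim: j X => [|j IHj] X X_fg Xj /=.
  by move=> u; rewrite -[u]scale1r; apply: (Xj set0).
have [d [g gP]] := X_fg.
pose lin (c : 'I_d -> {set 'I_n} -> L) : X :=
  \sum_(i < d) \sum_(S : {set 'I_n} | #|S| == j) (c i S * (ext_base k S : L)) *: g i.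
pose bottom u := exists c, u = lin c.
have bottom0 : bottom 0.
  exists (fun _ _ => 0); rewrite /lin big1 // => i _; rewrite big1 // => S _.
  by rewrite mul0r scale0r.
have bottomP x u w : bottom u -> bottom w -> bottom (x *: u + w).
  case=> c -> [c' ->]; exists (fun i S => x * c i S + c' i S); rewrite /lin.
  rewrite scaler_sumr -big_split; apply: eq_bigr => i _; rewrite scaler_sumr /=.
  rewrite -big_split; apply: eq_bigr => S _ /=.
  by rewrite scalerA mulrA -scalerDl -mulrDl.
pose A := Submod bottom0 bottomP.
have A_fg : fin_gen (submod_of A) := exterior_noetherian A X_fg.
have A1 : annihilated (submod_of A) 1.
  move=> T T1 u; apply: val_inj; have [c uE] := submod_valP u.
  rewrite /= uE scaler_sumr big1 // => i _; rewrite scaler_sumr big1 // => S /eqP jS.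
  rewrite scalerA; apply: annihilatedE Xj _; rewrite mulrA -jS -add1n.
  apply: deg_geM (@deg_ge_base S); rewrite -[1%N]addn0; apply: deg_geM => //.
  by move=> U U1; apply: deg_ge_base; apply: leq_trans U1 T1.
have [b [i i_bij]] := semisimple_triv A_fg A1.
exists 'I_b, (quot_mod A), (submod_incl A \o i : {linear _ -> _}), (quot_proj A).
split.
- by move=> s t /= /val_inj; exact: (bij_inj i_bij).
- exact: quot_pi_surj.
- move=> u; rewrite quot_proj0; split=> [Au|[s <-]]; last exact: (submod_valP (i s)).
  by have [i' _ iK] := i_bij; exists (i' (submod_mk Au)); rewrite /= iK.
apply: IHj; first exact: (@fin_gen_surj _ _ _ (quot_proj A) (@quot_pi_surj _ _ A) X_fg).
move=> S le_j q; have [u <-] := @quot_pi_surj _ _ A q.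
have -> : (ext_base k S : L) *: quot_pi A u = quot_proj A (ext_base k S *: u).
  by rewrite linearZ.
apply/quot_proj0; have [->|] := eqVneq (ext_base k S *: u) 0; first exact: submod0.
move=> nz; have {le_j} jS : #|S| == j.
  rewrite eqn_leq le_j andbT leqNgt; apply: contra nz => lt_j.
  by apply/eqP; apply: (Xj S).
have [c ->] := gP u; exists (fun i T => if T == S then (c i set0)%:A else 0).
rewrite scaler_sumr; apply: eq_bigr => i' _; rewrite (bigD1 S) //= eqxx.
rewrite big1 ?addr0 => [|T /andP[_ /negPf->]]; last by rewrite mul0r scale0r.
rewrite scalerA; apply/eqP; rewrite -subr_eq0 -scalerBl; apply/eqP.
apply: annihilatedE Xj _; rewrite ext_algl -ext_algr -mulrBr -addn1 -(eqP jS).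
apply: deg_geM; first exact: deg_ge_base.
by apply/deg_ge1; rewrite !ffunE eqxx /GRing.scale /= mulr1 subrr.
Qed.

(** Nakayama: the cover by minimal generators is essential because its kernel
    lies in the nilpotent radical. *)
Lemma projective_cover_exists (X : lmodType L) : fin_gen X ->
  exists d (p : {linear {ffun 'I_d -> L^o} -> X}), projective_cover p /\
    forall u, p u = 0 -> forall i, deg_ge 1 (u i : L).
Proof.
case/local_generators=> d [g [gP gmin]].
pose p := comb_map g; have p_surj : surj p.
  move=> u; have [c ->] := gP u; exists (finfun c).
  by rewrite comb_mapE; apply: eq_bigr => i _; rewrite ffunE.
have kerp u : p u = 0 -> forall i, deg_ge 1 (u i : L) by exact: gmin.
exists d, p; split=> //; split.
- exact: fin_gen_free.
- by apply: in_add_projective; apply: in_add_ffun; exact: in_add_refl.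
split=> // A f pf_surj.
have [a aE] := fin_all_exists (fun i => pf_surj (p (free_basis L i))).
(* By assumption f reaches the basis modulo the radical. *)
have near i l : deg_ge 1 ((f (a i) - free_basis L i) l : L).
  by apply: kerp; rewrite linearB; apply/eqP; rewrite subr_eq0; apply/eqP; exact: aE.
suff im : forall s (u : {ffun 'I_d -> L^o}),
    (forall i, deg_ge (n.+1 - s) (u i : L)) -> exists w, f w = u.
  by move=> u; apply: (im n.+1) => i; rewrite subnn; exact: deg_ge0.
elim=> [|s IHs] u su.
  exists 0; rewrite linear0; apply/ffunP=> i; rewrite ffunE; apply/esym.
  by apply: deg_ge_max; rewrite -[n.+1]subn0.
pose w0 := \sum_i (u i : L) *: a i.
have [|w wE] := IHs (u - f w0).
  move=> l; have -> : (u - f w0) l = - \sum_i (u i : L) * (f (a i) - free_basis L i) l.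
    rewrite [in LHS](free_basisE u) linear_sum -sumrB sum_ffunE -sumrN.
    apply: eq_bigr => i _; rewrite linearZ -scalerBr -opprB scalerN.
    by rewrite !ffunE.
  have [le_sn|lt_ns] := leqP s n; last first.
    by have -> : (n.+1 - s = 0)%N by apply/eqP; rewrite subn_eq0.
  rewrite subSn // -[(n - s).+1]addn1 => S ltS; rewrite ffunE.
  rewrite [X in - X](@deg_ge_sum _ _ (n - s + 1)) ?oppr0 // => i _.
  by apply: deg_geM (near i l); rewrite -subSS.
by exists (w + w0); rewrite linearD wE subrK.
Qed.

(** * The upper bound *)

Lemma exterior_Igusa_Todorov : (0 < n)%N -> Igusa_Todorov L n.-1 1.
Proof.
move=> n_gt0; pose Om := Omega exterior_noetherian triv_module.
pose U : nat -> lmodType L :=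
  fix U m := if m is m'.+1 then (U m' * Om m')%type : lmodType L else L^o.
have U_fg m : fin_gen (U m).
  elim: m => [|m IHm] /=; last exact: fin_gen_prod IHm (fg_fin _).
  apply/fin_genP; exists 'I_1, (ev_map L^o ord0) => x.
  by exists [ffun => x]; rewrite /= ffunE.
have addL m : in_add (U m) L^o.
  elim: m => [|m IHm]; first exact: in_add_refl.
  exact: in_add_trans (in_add_fst _ _) IHm.
have addOm m i : (i < m)%N -> in_add (U m) (Om i).
  elim: m => // m IHm; rewrite ltnS leq_eqVlt => /orP[/eqP->|/IHm].
    exact: in_add_snd.
  exact: in_add_trans (in_add_fst _ _).
exists (U n); split=> // M M_fg.
have [d [p [p_cover kerp]]] := projective_cover_exists M_fg.
exists (submod_of (ker_mod p)); split.
  exists M; split; first by exists idfun; exists id.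
  exists {ffun 'I_d -> L^o}, p, (submod_incl (ker_mod p)); split=> //.
    exact: ker_incl_inj.
  exact: ker_incl_exact.
apply: (@filtered_resolution _ exterior_noetherian triv_module _ 0) => // [i le_i|].
  by apply: addOm; rewrite add0n -(prednK n_gt0).
rewrite prednK //; apply: annihilated_filtered.
  by apply: exterior_noetherian; exact: fin_gen_free.
move=> S nS u; apply: val_inj; apply/ffunP=> i; rewrite /= !ffunE.
apply: deg_ge_max; rewrite -addn1; apply: deg_geM.
  by move=> T ltT; apply: deg_ge_base; apply: leq_trans ltT nS.
exact: kerp (submod_valP u) i.
Qed.
End ExteriorModules.

(** * Separable extensions with many elements *)

Section IrreduciblePolynomials.
Variable k : fieldType.
Implicit Types (p q f g : {poly k}) (s : seq k).

Lemma irreducible_factor p : (1 < size p)%N ->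
  exists2 f, irreducible_poly f & f %| p.
Proof.
move=> p_gt1.
pose Q m := `[< exists q, [/\ (1 < size q)%N, q %| p & size q = m] >].
have exQ : exists m, Q m by exists (size p); apply/asboolP; exists p; rewrite dvdpp.
case: (ex_minnP exQ) => m /asboolP[f [f_gt1 fp fm]] min_m.
have p0 : p != 0 by rewrite -size_poly_gt0 ltnW.
exists f => //; split=> // q q1 qf.
have f0 : f != 0 by rewrite -size_poly_gt0 ltnW.
have q0 : q != 0 by apply: contraNneq f0 => q0; move: qf; rewrite q0 dvd0p.
rewrite -dvdp_size_eqp // eqn_leq dvdp_leq //= fm min_m //; apply/asboolP.
exists q; split=> //; last exact: dvdp_trans qf fp.
by rewrite ltn_neqAle eq_sym q1 size_poly_gt0.
Qed.

Fixpoint short_polys s m : seq {poly k} :=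
  if m is m'.+1 then [seq c%:P + 'X * p | c <- s, p <- short_polys s m'] else [:: 0].

Lemma mem_short_polys s m p : (forall x, x \in s) -> (size p <= m)%N ->
  p \in short_polys s m.
Proof.
move=> s_all; elim: m p => [|m IHm] p /=.
  by rewrite leqn0 size_poly_eq0 => /eqP->; rewrite inE.
elim/poly_ind: p => [|q c _] sp.
  apply/allpairsP; exists (0, 0); rewrite s_all IHm ?size_poly0 //=.
  by split=> //; rewrite polyC0 mulr0 addr0.
apply/allpairsP; exists (c, q); rewrite s_all /= [RHS]addrC commr_polyX; split=> //.
apply: IHm; have [->|q0] := eqVneq q 0; first by rewrite size_poly0.
by move: sp; rewrite size_MXaddC (negPf q0).
Qed.

Lemma finite_char s : (forall x, x \in s) -> exists2 p : nat, (0 < p)%N & p%:R = 0 :> k.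
Proof.
move=> s_all; apply: contrapT => no_p.
have lt_inj (i j : nat) : (i < j)%N -> i%:R = j%:R :> k -> False.
  move=> ltij eq_ij; apply: no_p; exists (j - i)%N; first by rewrite subn_gt0.
  by rewrite natrB ?eq_ij ?subrr // ltnW.
have inj : injective (fun i : nat => i%:R : k).
  move=> i j; case: (ltngtP i j) => // lt; first by move/(lt_inj _ _ lt).
  by move/esym/(lt_inj _ _ lt).
have := @uniq_leq_size _ (map (fun i : nat => i%:R : k) (iota 0 (size s).+1)) s.
rewrite map_inj_uniq // iota_uniq size_map size_iota ltnn => /(_ isT).
by move=> H; have := H (fun x _ => s_all x).
Qed.

(** Euclid's argument: an irreducible factor of 1 + X * G ^ p, where G is the
    product of all nonzero polynomials of small size, has large size. Taking the
    exponent p to be 0 in k makes the derivative of 1 + X * G ^ p equal to G ^ p,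
    hence this polynomial separable. *)
Lemma large_separable s m : (forall x, x \in s) ->
  exists f, [/\ irreducible_poly f, separable_poly f & (m < size f)%N].
Proof.
move=> s_all; have [p p_gt0 p0] := finite_char s_all.
pose G := \prod_(q <- short_polys s m | q != 0) q.
have G0 : G != 0.
  by rewrite /G prodf_seq_neq0; apply/allP => q _; apply/implyP.
pose P := 1 + G ^+ p * 'X.
have P_sep : separable_poly P.
  rewrite separable_poly.unlock; have -> : P^`() = G ^+ p.
    rewrite /P derivD derivM derivX mulr1 deriv_exp -mulr_natr.
    by rewrite -[p%:R](rmorph_nat polyC) p0 !(mulr0, mul0r) -[1]polyC1 derivC !add0r.
  apply/Bezout_coprimepP; exists (1, - 'X) => /=.
  by rewrite mul1r mulNr mulrC addrK eqpxx.
have P_gt1 : (1 < size P)%N.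
  have Gp0 : G ^+ p != 0 by rewrite expf_neq0.
  have size_GX : (1 < size (G ^+ p * 'X : {poly k})%R)%N.
    by rewrite size_mulX // ltnS size_poly_gt0.
  by rewrite /P addrC size_polyDl // size_poly1.
have [f f_irr fP] := irreducible_factor P_gt1; exists f; split=> //.
  exact: dvdp_separable fP P_sep.
rewrite ltnNge; apply/negP => f_le.
have [f_gt1 _] := f_irr.
have f0 : f != 0 by rewrite -size_poly_gt0 ltnW.
have fG : f %| G.
  by rewrite /G (big_rem f) ?mem_short_polys //= f0 dvdp_mulr.
have : f %| 1.
  by rewrite -(dvdp_addl _ (dvdp_mulr 'X (dvdp_exp p_gt0 fG))) //.
by rewrite dvdp1 => /eqP f1; rewrite f1 in f_gt1.
Qed.
End IrreduciblePolynomials.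

Section Casimir.
Variables (k : fieldType) (K : fieldExtType k) (f : {poly k}) (z : K).
Hypotheses (f_irr : irreducible_poly f) (f_sep : separable_poly f).
Hypotheses (K_dim : \dim {:K} = (size f).-1).
Hypotheses (fz : root (map_poly (in_alg K) f) z) (K_gen : <<1; z>>%VS = fullv).

Let d := (size f).-1.
Definition power_basis : d.-tuple K := [tuple z ^+ i | i < d].

Lemma power_basisE (i : 'I_d) : power_basis`_i = z ^+ i.
Proof. by rewrite -tnth_nth tnth_mktuple. Qed.

Lemma power_basisP : basis_of fullv power_basis.
Proof.
rewrite basisEdim size_tuple K_dim leqnn andbT; apply/subvP => x _.
have f0 : f != 0 by rewrite -size_poly_gt0 ltnW //; case: f_irr.
have : x \in <<1; z>>%VS by rewrite K_gen memvf.
case/Fadjoin_polyP=> _ /polyOver1P[q ->] ->.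
rewrite (divp_eq q f) rmorphD rmorphM hornerD hornerM (rootP fz) mulr0 add0r.
have sz : (size (map_poly (in_alg K) (q %% f)) <= d)%N.
  rewrite size_map_poly -ltnS /d prednK ?ltn_modp // size_poly_gt0 //.
rewrite (horner_coef_wide _ sz); apply: memv_suml => i _.
rewrite coef_map /= -scalerAl mul1r memvZ // -power_basisE.
by rewrite memv_span // mem_nth // size_tuple.
Qed.

(** Write f = (X - z) * g over K. The element of the tensor square of K over k with
    components g_j on the powers z ^ j is the same for the two actions of K; the
    product map sends it to f'(z), nonzero because f is separable. *)
Lemma Casimir_exists : exists b' : 'I_d -> K,
  (forall c a, \sum_(e < d) coord power_basis a (c * power_basis`_e) *: b' e = c * b' a) /\
  \sum_(a < d) power_basis`_a * b' a != 0.
Proof.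
have f0 : f != 0 by rewrite -size_poly_gt0 ltnW //; case: f_irr.
have b_free : free power_basis := basis_free power_basisP.
have [g fE] := factor_theorem _ _ fz.
have sz_g : size g = d.
  have : size (map_poly (in_alg K) f) = size f by rewrite size_map_poly.
  by rewrite fE size_Mmonic ?monicXsubC ?size_XsubC ?addn2 /d => [<-||] //;
    apply: contraTneq f0 => g0; move/eqP: fE; rewrite g0 mul0r map_poly_eq0 => ->.
have fgE j : (f`_j)%:A = (if j is j'.+1 then g`_j' else 0) - g`_j * z.
  have := congr1 (fun q : {poly K} => q`_j) fE; rewrite coef_map /= => ->.
  by rewrite mulrBr coefB coefMC coefMX; case: j.
exists (fun a => g`_a); split; last first.
  have fdE : (map_poly (in_alg K) f)^`().[z] = g.[z].
    rewrite fE derivM derivXsubC hornerD hornerM hornerXsubC subrr mulr0 add0r.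
    by rewrite ?mulr1 ?hornerE ?mulr1.
  have -> : \sum_(a < d) power_basis`_a * g`_a = g.[z].
    rewrite (horner_coef_wide z (eq_leq sz_g)); apply: eq_bigr => a _.
    by rewrite power_basisE mulrC.
  have : separable_poly (map_poly (in_alg K) f) by rewrite separable_map.
  by rewrite separable_poly.unlock -fdE => /coprimep_root; apply.
pose C c := forall a : 'I_d,
  \sum_(e < d) coord power_basis a (c * power_basis`_e) *: g`_e = c * g`_a.
have CM c c' : C c -> C c' -> C (c * c').
  move=> Cc Cc' a; rewrite mulrAC -Cc mulr_suml.
  transitivity (\sum_(e < d) \sum_(h < d) (coord power_basis a (c * power_basis`_h)
      * coord power_basis h (c' * power_basis`_e)) *: g`_e).
    apply: eq_bigr => e _; rewrite -scaler_suml; congr (_ *: _).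
    rewrite -mulrA {1}(coord_basis power_basisP (memvf (c' * power_basis`_e))).
    rewrite mulr_sumr linear_sum; apply: eq_bigr => h _ /=.
    by rewrite -scalerAr linearZ /= mulrC.
  rewrite exchange_big; apply: eq_bigr => h _ /=.
  rewrite -scalerAl [g`_h * c']mulrC -Cc' scaler_sumr.
  by apply: eq_bigr => e _; rewrite scalerA.
have C1 : C 1.
  move=> a; rewrite mul1r (bigD1 a) //= mul1r coord_free // eqxx scale1r.
  rewrite big1 ?addr0 // => e ne_ea.
  by rewrite mul1r coord_free // (negPf ne_ea) scale0r.
(* The two sides differ by the sum of the coordinates of the z ^ j against the
   coefficients of f, that is, by a coordinate of f(z) = 0. *)
have Cz : C z.
  move=> a; pose h j := coord power_basis a (z ^+ j).
  have h0 : \sum_(j < d.+1) h j *: ((f`_j)%:A : K) = 0.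
    have sz_f : (size (map_poly (in_alg K) f) <= d.+1)%N.
      by rewrite size_map_poly /d; case: (size f).
    have eq0 : \sum_(j < d.+1) f`_j * h j = 0.
      rewrite -[RHS](linear0 (coord power_basis a)) -(rootP fz).
      rewrite (horner_coef_wide _ sz_f) linear_sum; apply: eq_bigr => j _.
      by rewrite coef_map /= -scalerAl mul1r linearZ.
    rewrite -[RHS](scale0r (1 : K)) -[X in _ = X *: _]eq0 scaler_suml.
    by apply: eq_bigr => j _; rewrite scalerA mulrC.
  have g0 : \sum_(e < d) h e *: g`_e = g`_a.
    by rewrite -[RHS]mul1r -C1; apply: eq_bigr => e _; rewrite mul1r power_basisE.
  move: h0; under eq_bigr do rewrite fgE scalerBr; rewrite sumrB.
  rewrite big_ord_recl /= scaler0 add0r [X in _ - X]big_ord_recr /=.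
  rewrite [g`_d]nth_default ?sz_g // mul0r scaler0 addr0 => /eqP.
  rewrite subr_eq0 => /eqP eq_h.
  transitivity (\sum_(e < d) h (bump 0 e) *: g`_e).
    by apply: eq_bigr => e _; rewrite power_basisE -exprS.
  rewrite eq_h -g0 mulr_sumr; apply: eq_bigr => e _.
  by rewrite -scalerAr mulrC.
have CX j : C (z ^+ j) by elim: j => // j IHj; rewrite exprS; exact: CM.
move=> c a; rewrite (coord_basis power_basisP (memvf c)) [RHS]mulr_suml.
under eq_bigr do rewrite mulr_suml linear_sum scaler_suml.
rewrite exchange_big; apply: eq_bigr => j _.
rewrite power_basisE -scalerAl -CX scaler_sumr; apply: eq_bigr => e _.
by rewrite -scalerAl linearZ scalerA.
Qed.
End Casimir.

Lemma large_separable_extension (k : fieldType) m :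
  exists (K : fieldExtType k) (d : nat) (b : d.-tuple K) (b' : 'I_d -> K),
    [/\ basis_of {:K} b,
        forall c a, \sum_(e < d) coord b a (c * b`_e) *: b' e = c * b' a,
        \sum_(a < d) b`_a * b' a != 0
      & exists2 s : seq K, uniq s & (m <= size s)%N].
Proof.
suff [f [f_irr f_sep sP]] : exists f : {poly k}, [/\ irreducible_poly f, separable_poly f &
    (m < size f)%N \/ exists2 s : seq k, uniq s & (m <= size s)%N].
  have [K K_dim [z fz K_gen]] := irredp_FAdjoin f_irr.
  have [b' [b'P b'0]] := Casimir_exists f_irr f_sep K_dim fz K_gen.
  have b_basis := power_basisP f_irr K_dim fz K_gen.
  exists K, (size f).-1, (power_basis f z), b'; split=> //.
  case: sP => [lt_m|[s s_uniq le_m]].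
    exists (power_basis f z); first exact: free_uniq (basis_free b_basis).
    by rewrite size_tuple -ltnS prednK // (leq_ltn_trans _ lt_m).
  exists (map (in_alg K) s); last by rewrite size_map.
  by rewrite map_inj_uniq //; exact: fmorph_inj.
have [ex_s|no_s] := pselect (exists2 s : seq k, uniq s & (m <= size s)%N).
  exists ('X - 0%:P); split; [exact: irredp_XsubC| |by right].
  by rewrite separable_poly.unlock derivXsubC coprimep1.
pose P j := `[< exists2 s : seq k, uniq s & size s = j >].
have exP : exists j, P j by exists 0%N; apply/asboolP; exists [::].
have [|j /asboolP[s s_uniq sj] max_j] := @ex_maxnP P m exP.
  move=> j /asboolP[s s_uniq sj]; rewrite leqNgt; apply/negP => lt_mj.
  by apply: no_s; exists s; rewrite // sj ltnW.
have s_all x : x \in s.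
  apply: contraT => xs; have /max_j : P j.+1.
    by apply/asboolP; exists (x :: s); rewrite /= ?xs ?sj.
  by rewrite ltnn.
have [f [f_irr f_sep lt_m]] := large_separable m s_all.
by exists f; split=> //; left.
Qed.

(** * Matrices of largest rank *)

(** If a basis of the row space of A together with X *m B were independent, then the
    same rows of A + t B would be independent for all t <> 0 outside the finite set of
    roots of a characteristic polynomial; but they lie in the row space of
    A + t B, which has smaller dimension. *)
Lemma max_rank_tangent (K : fieldType) D (A B : 'M[K]_D) (X : 'rV_D) (s : seq K) :
    uniq s -> (D.+3 <= size s)%N -> (forall t, (\rank (A + t *: B)%R <= \rank A)%N) ->
  X *m A = 0 -> (X *m B <= A)%MS.
Proof.
move=> s_uniq sz_s rank_max XA0; apply: contraT => XB_A.
have /submxP[U UA] : (row_base A <= A)%MS by rewrite eq_row_base.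
pose r := \rank A; pose C := col_mx (U *m A) (X *m B).
have C_free : row_free C.
  rewrite /row_free eqn_leq rank_leq_row /= -addsmxE -UA addn1.
  rewrite (adds_eqmx (eq_row_base A) (eqmx_refl _)); apply: rank_ltmx.
  by rewrite /ltmx addsmxSl addsmx_sub submx_refl.
pose Z := pinvmx C; have CZ : C *m Z = 1%:M by rewrite mulmxVp.
pose Y := col_mx (U *m B) (0 : 'rV_D) *m Z.
(* For t <> 0 the rows of C + t (U B, 0) lie in the row space of A + t B. *)
have root_Y u : u != 0 -> root (char_poly Y) u.
  move=> u0; rewrite -eigenvalue_root_char /eigenvalue kermx_eq0.
  pose t := - u^-1; have t0 : t != 0 by rewrite oppr_eq0 invr_eq0.
  have tu : u = - t^-1 by rewrite /t invrN invrK opprK.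
  apply: contraTN (rank_max t) => free_Y; rewrite -ltnNge.
  have free_tY : row_free (1%:M + t *: Y).
    have -> : 1%:M + t *: Y = t *: (Y - u%:M).
      rewrite tu raddfN opprK scalerDr addrC scale_scalar_mx mulfV //.
    by rewrite /row_free mxrank_scale_nz.
  have E : 1%:M + t *: Y = (C + t *: col_mx (U *m B) 0) *m Z.
    by rewrite mulmxDl CZ -scalemxAl.
  have sub : ((C + t *: col_mx (U *m B) 0)%R <= (A + t *: B)%R)%MS.
    rewrite scale_col_mx add_col_mx scaler0 addr0 scalemxAr -mulmxDr.
    rewrite col_mx_sub submxMl /=.
    have -> : X *m B = t^-1 *: X *m (A + t *: B).
      rewrite mulmxDr -!scalemxAl XA0 scaler0 add0r -scalemxAr scalerA mulVf ?scale1r //.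
    exact: submxMl.
  rewrite E in free_tY; apply: leq_trans (mxrankS sub).
  by apply: leq_trans (mxrankM_maxl _ Z); move/eqP: free_tY => ->; rewrite addn1.
pose s' := rem 0 s.
have := @max_poly_roots _ (char_poly Y) s' (monic_neq0 (char_poly_monic Y)).
rewrite (rem_uniq 0 s_uniq) // size_char_poly => /(_ _ isT) le_r.
have /le_r : all (root (char_poly Y)) s'.
  by apply/allP => u; rewrite mem_rem_uniq // inE => /andP[u0 _]; exact: root_Y.
have : (D.+1 < size s')%N.
  rewrite /s'.
  have [s0|s0] := boolP (0 \in s); last by rewrite rem_id // ltnW.
  by rewrite size_rem // -ltnS prednK // (leq_trans _ sz_s).
move=> lt_D lt_r; have := leq_ltn_trans lt_D lt_r.
by rewrite addn1 !ltnS ltnNge rank_leq_row.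
Qed.

(** * Products of generators *)

Section Generators.
Variables (k : fieldType) (n : nat).
Local Notation L := (exterior k n).
Implicit Types (i j : 'I_n) (js : seq 'I_n) (S T U : {set 'I_n}) (x y : L).

Definition gen i : L := ext_base k [set i].
Definition word js : L := \prod_(j <- js) gen j.

Lemma gen_anti i j : gen i * gen j = - (gen j * gen i).
Proof. exact: ext_gen_anti. Qed.
Lemma gen_sq i : gen i * gen i = 0. Proof. exact: ext_gen_sq. Qed.

Lemma ext_sign_sq S T : [disjoint S & T] -> ext_sign k S T * ext_sign k S T = 1.
Proof. by rewrite /ext_sign => ->; rewrite -expr2 -exprM mulnC exprM sqrrN !expr1n. Qed.

Lemma gen_base i S :
  gen i * ext_base k S = ext_sign k [set i] S *: ext_base k (i |: S).
Proof. by rewrite ext_mulE ext_mul_base. Qed.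

(** L is generated by the e_i as an algebra. *)
Lemma ext_gen_ind (Q : L -> Prop) :
    (forall a x y, Q x -> Q y -> Q (a *: x + y)) -> Q 0 -> Q 1 ->
    (forall i x, Q x -> Q (gen i * x)) ->
  forall x, Q x.
Proof.
move=> Qlin Q0 Q1 Qgen x.
suff Qbase S : Q (ext_base k S).
  rewrite (ext_baseE x); apply: (big_ind Q) => // [y z Qy Qz|S _].
    by rewrite -[y]scale1r; exact: Qlin.
  by rewrite -[_ *: _]addr0; exact: Qlin.
have [m] := ubnP #|S|; elim: m S => // m IHm S lt_m.
have [->|/set0Pn[i iS]] := eqVneq S set0; first exact: Q1.
have iS' : i \notin S :\ i by rewrite setD11.
have dis : [disjoint [set i] & S :\ i] by rewrite disjoints1.
have -> : (ext_base k S : L) =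
    ext_sign k [set i] (S :\ i) *: (gen i * ext_base k (S :\ i)) + 0.
  by rewrite gen_base scalerA ext_sign_sq // scale1r setD1K // addr0.
apply: Qlin => //; apply/Qgen/IHm; rewrite -ltnS; apply: leq_trans lt_m.
by rewrite [#|S|](cardsD1 i) iS.
Qed.

Lemma word_base js : uniq js -> exists2 a : k, a != 0 &
  word js = a *: (ext_base k [set j in js] : L).
Proof.
elim: js => [|j js IHjs] /=.
  exists 1; rewrite ?oner_eq0 // /word big_nil scale1r.
  by congr ext_base; apply/setP=> i; rewrite !inE.
case/andP=> js_j /IHjs[a a0 jsE].
have nj : j \notin [set i in js] by rewrite inE.
have dis : [disjoint [set j] & [set i in js]] by rewrite disjoints1.
exists (a * ext_sign k [set j] [set i in js]).
  rewrite mulf_neq0 //; apply: contra_eq_neq (ext_sign_sq dis) => ->.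
  by rewrite mul0r eq_sym oner_eq0.
rewrite /word big_cons -/(word js) jsE -scalerAr gen_base scalerA.
by congr (_ *: ext_base _ _); apply/setP=> i; rewrite !inE.
Qed.

Lemma word_gen0 js j : uniq js -> j \in js -> word js * gen j = 0.
Proof.
case/word_base=> a _ -> js_j; rewrite -scalerAl ext_mulE ext_mul_base /ext_sign.
by rewrite disjoint_sym disjoints1 inE js_j scale0r scaler0.
Qed.

Lemma word_gen_neq0 js j : uniq js -> j \notin js -> word js * gen j != 0.
Proof.
move=> js_uniq js_j; have -> : word js * gen j = word (rcons js j).
  by rewrite /word -cats1 big_cat big_seq1.
have [|a a0 ->] := @word_base (rcons js j); first by rewrite rcons_uniq js_j.
rewrite scaler_eq0 (negPf a0) /=; apply/eqP => /ffunP/(_ [set i in rcons js j]).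
by rewrite !ffunE eqxx => /eqP; rewrite oner_eq0.
Qed.

Lemma gen_coef i x U : (gen i * x) U =
  if i \in U then ext_sign k [set i] (U :\ i) * x (U :\ i) else 0.
Proof.
rewrite ext_coefM (bigD1 [set i]) //= [X in _ + X]big1 ?addr0 => [|S nS]; last first.
  by rewrite big1 // => T _; rewrite ffunE (negPf nS) mul0r mulr0 mul0r.
case: ifP => iU.
  rewrite (bigD1 (U :\ i)) //= setD1K // eqxx ffunE eqxx mul1r mulr1.
  rewrite big1 ?addr0 // => T nT; rewrite /ext_sign disjoints1.
  case: (boolP (i \in T)) => iT /=; first by rewrite !mul0r.
  case: eqP => [eU|]; last by rewrite mulr0.
  by move: nT; rewrite eU setU1K // eqxx.
rewrite big1 // => T _; case: eqP => [eU|]; last by rewrite mulr0.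
by rewrite eU setU11 in iU.
Qed.

(** The interior product by the j-th coordinate form; with the multiplication by
    e_i it satisfies the anticommutation rule of [contract_gen]. *)
Definition contract j x : L :=
  [ffun S : {set 'I_n} => if j \in S then 0 else ext_sign k [set j] S * x (j |: S)].

Lemma contract_linear j : linear (contract j).
Proof.
move=> a x y; apply/ffunP=> S; rewrite !ffunE; case: ifP => _.
  by rewrite scaler0 addr0.
by rewrite mulrDr; congr (_ + _); rewrite /GRing.scale /= mulrCA.
Qed.

Lemma contract_gen i j x :
  gen i * contract j x + contract j (gen i * x) = (i == j)%:R *: x.
Proof.
apply/ffunP=> S; rewrite ffunE gen_coef [contract j (gen i * x) S]ffunE gen_coef.
rewrite ext_scaleE !ffunE; have [<-|ne_ij] := eqVneq i j.
  rewrite !inE eqxx mul1r /=; case: ifP => iS.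
    by rewrite setD1K // addr0 mulrA ext_sign_sq ?mul1r // disjoints1 setD11.
  by rewrite setU1K ?iS // add0r mulrA ext_sign_sq ?mul1r // disjoints1 iS.
rewrite mul0r !inE (negPf ne_ij) [j == i]eq_sym (negPf ne_ij) /=.
case: ifP => iS; case: ifP => jS; rewrite ?(mulr0, addr0) //.
set T := S :\ i; have ST : S = i |: T by rewrite setD1K.
have -> : (j |: S) :\ i = j |: T.
  by apply/setP=> l; rewrite !inE; case: eqVneq => // ->; rewrite (negPf ne_ij).
rewrite ST; set xT := x _.
have iT : i \notin T by rewrite setD11.
have jT : j \notin T by rewrite !inE jS andbF.
have dis_iT : [disjoint [set i] & T] by rewrite disjoints1.
have sq_iT := ext_sign_sq dis_iT.
have dij : [disjoint [set i] & [set j]] by rewrite disjoints1 inE.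
have sij : ext_sign k [set i] [set j] = - ext_sign k [set j] [set i].
  have := gen_anti i j; rewrite !ext_mulE !ext_mul_base [[set j] :|: _]setUC.
  move/ffunP/(_ ([set i] :|: [set j])); rewrite !ffunE eqxx /GRing.scale /=.
  by rewrite !mulr1.
have c1 := ext_sign_cocycle k [set i] [set j] T.
have c2 := ext_sign_cocycle k [set j] [set i] T.
have sq_d : ext_sign k [set i] (j |: T) * ext_sign k [set i] (j |: T) = 1.
  by apply: ext_sign_sq; rewrite disjoints1 in_setU1 (negPf ne_ij).
have bd_ac : ext_sign k [set j] T * ext_sign k [set i] (j |: T) =
    - (ext_sign k [set i] T * ext_sign k [set j] (i |: T)).
  by rewrite -c1 -c2 sij mulNr setUC.
rewrite !mulrA -mulrDl -[X in X * xT]mulr1 -[X in _ * X * xT]sq_d.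
rewrite [X in X * xT]mulrA [X in X * _ * xT]mulrDl -(mulrA _ _ (ext_sign _ _ _)) bd_ac.
rewrite mulrN mulrA sq_iT mul1r -(mulrA _ _ (ext_sign _ [set i] _)) sq_d mulr1.
by rewrite addNr !mul0r.
Qed.
End Generators.

(** * Square-zero operators on scalar extensions *)

Section ScalarExtension.
Variables (k : fieldType) (n : nat) (K : fieldExtType k) (d : nat) (b : d.-tuple K).
Hypothesis b_basis : basis_of {:K} b.
Local Notation L := (exterior k n).
Local Notation "X ^K" := {ffun 'I_d -> X} (at level 2, format "X ^K").
Implicit Types (X Y V W P : lmodType L) (c : K) (js : seq 'I_n).

(** The family x of elements of X stands for the sum of the b_a tensor x_a in
    the scalar extension of X to K, and act c for the multiplication by c. *)
Definition act X c (x : X^K) : X^K :=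
  [ffun a => \sum_(e < d) ((coord b a (c * b`_e))%:A : L) *: x e].

Lemma act_linear X c : linear (@act X c).
Proof.
move=> y u w; apply/ffunP=> a; rewrite !ffunE scaler_sumr -big_split.
apply: eq_bigr => e _ /=; rewrite !ffunE scalerDr !scalerA.
by rewrite ext_algl ext_algr.
Qed.
HB.instance Definition _ X c :=
  GRing.isLinear.Build L X^K X^K *:%R (@act X c) (@act_linear X c).

Lemma actDl X c c' (x : X^K) : act (c + c') x = act c x + act c' x.
Proof.
apply/ffunP=> a; rewrite !ffunE -big_split; apply: eq_bigr => e _ /=.
by rewrite -scalerDl -scalerDl mulrDl linearD.
Qed.

Lemma act0l X (x : X^K) : act 0 x = 0.
Proof. by apply: (addrI (act 0 x)); rewrite -actDl !addr0. Qed.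

Lemma actA X c c' (x : X^K) : act c (act c' x) = act (c * c') x.
Proof.
apply/ffunP=> a; rewrite !ffunE; under eq_bigr do rewrite ffunE scaler_sumr.
rewrite exchange_big; apply: eq_bigr => e _ /=.
under eq_bigr do rewrite scalerA ext_algl scalerA.
rewrite -!scaler_suml; congr (_ *: _); congr (_ *: _).
rewrite -mulrA {2}(coord_basis b_basis (memvf (c' * b`_e))) mulr_sumr linear_sum.
by apply: eq_bigr => h _; rewrite -scalerAr linearZ /= mulrC.
Qed.

Lemma act1 X (x : X^K) : act 1 x = x.
Proof.
have b_free := basis_free b_basis.
apply/ffunP=> a; rewrite ffunE (bigD1 a) //= mul1r coord_free // eqxx scale1r scale1r.
rewrite big1 ?addr0 // => e ne_ea.
by rewrite mul1r coord_free // (negPf ne_ea) scale0r scale0r.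
Qed.

Lemma act_alg X (a : k) (x : X^K) : act a%:A x = (a%:A : L) *: x.
Proof.
have b_free := basis_free b_basis.
apply/ffunP=> j; rewrite !ffunE (bigD1 j) //=.
rewrite -scalerAl mul1r linearZ /= coord_free // eqxx mulr1.
rewrite big1 ?addr0 // => e ne_ej.
rewrite -scalerAl mul1r linearZ /= coord_free // (negPf ne_ej).
by rewrite mulr0 scale0r scale0r.
Qed.

Lemma act_map X Y (f : {linear X -> Y}) c (x : X^K) :
  ffun_map _ f (act c x) = act c (ffun_map _ f x).
Proof.
apply/ffunP=> a; rewrite !ffunE linear_sum; apply: eq_bigr => e _.
by rewrite linearZ ffunE.
Qed.

Variable lam : 'I_n -> K.

(** The multiplication by the vector lam of K^n, on the scalar extension of X. *)
Definition op X (x : X^K) : X^K := \sum_i act (lam i) (gen k i *: x).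

Lemma op_additive X : {morph @op X : x y / x - y}.
Proof.
by move=> x y; rewrite /op -sumrB; apply: eq_bigr => i _; rewrite scalerBr linearB.
Qed.
HB.instance Definition _ X :=
  GRing.isZmodMorphism.Build X^K X^K (@op X) (@op_additive X).

Lemma op_map X Y (f : {linear X -> Y}) (x : X^K) :
  ffun_map _ f (op x) = op (ffun_map _ f x).
Proof.
by rewrite linear_sum; apply: eq_bigr => i _; rewrite act_map linearZ.
Qed.

Lemma op_act X c (x : X^K) : op (act c x) = act c (op x).
Proof.
rewrite [act c (op x)]linear_sum; apply: eq_bigr => i _.
by rewrite -[gen k i *: act c x]linearZ [LHS]actA [RHS]actA mulrC.
Qed.

Lemma op_gen X j (x : X^K) : op (gen k j *: x) = - (gen k j *: op x).
Proof.
rewrite /op scaler_sumr -sumrN; apply: eq_bigr => i _.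
by rewrite -linearZ -linearN -scaleNr !scalerA gen_anti mulNr.
Qed.

Lemma op_op X (x : X^K) : op (op x) = 0.
Proof.
rewrite {1}/op; under eq_bigr do rewrite scaler_sumr linear_sum.
under eq_bigr do under eq_bigr do rewrite -linearZ /= actA scalerA.
apply: sum_alt_sq => [i|i j]; first by rewrite gen_sq scale0r linear0.
by rewrite gen_anti scaleNr linearN mulrC.
Qed.

(** Cycles form an L-module, though op commutes with L only up to sign. *)
Lemma op_scale0 X (y : L) (x : X^K) : op x = 0 -> op (y *: x) = 0.
Proof.
move: y; apply: ext_gen_ind => [a y z IHy IHz Dx|||i y IHy Dx].
- have -> : (a *: y + z) *: x = act a%:A (y *: x) + z *: x.
    by rewrite scalerDl act_alg -ext_algl -scalerA.
  by rewrite raddfD /= op_act IHy // IHz // linear0 addr0.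
- by rewrite scale0r raddf0.
- by rewrite scale1r.
- by rewrite -scalerA op_gen IHy // scaler0 oppr0.
Qed.

Lemma op_word X js (x : X^K) :
  op (word k js *: x) = (-1) ^+ size js *: (word k js *: op x).
Proof.
elim: js => [|j js IHjs]; first by rewrite /word big_nil !scale1r.
rewrite /word big_cons -/(word k js) -!scalerA op_gen IHjs /= exprS mulN1r scaleNr.
by rewrite [in LHS]scalerA commr_sign -!scalerA.
Qed.

(** The products of s generators are 0 on the homology of op: they send cycles
    to boundaries. *)
Definition kills X s : Prop := forall x : X^K, op x = 0 ->
  forall js, size js = s -> exists y, op y = word k js *: x.

Lemma op_sign X s (x : X^K) : op (((-1) ^+ s : L) *: x) = ((-1) ^+ s : L) *: op x.
Proof.
by elim: s => [|s IHs]; rewrite ?scale1r // exprS mulN1r !scaleNr raddfN /= IHs.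
Qed.

Lemma killsS X s : kills X s -> kills X s.+1.
Proof.
move=> Xs x x0 [|j js] // [sz_js]; have [y yE] := Xs x x0 js sz_js.
by exists (- (gen k j *: y)); rewrite raddfN /= op_gen opprK yE /word big_cons scalerA.
Qed.

Lemma kills_le X s t : (s <= t)%N -> kills X s -> kills X t.
Proof. by move/subnK<-; elim: (t - s)%N => // m IHm Xs; apply/killsS/IHm. Qed.

(** Exactness of H(Y) -> H(X) -> H(X') and compatibility of the connecting map with
    the generators, up to sign: s generators send a class of X into the image of
    H(Y), where t more generators kill it. *)
Lemma kills_extension X' Y X (i : {linear X' -> Y}) (p : {linear Y -> X}) s t :
    injective i -> exact_at i p -> surj p -> kills X' s -> kills Y t ->
  kills X (t + s).
Proof.
move=> i_inj ip p_surj X's Yt x x0 js sz_js.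
have lift (u : X^K) : exists y : Y^K, ffun_map _ p y = u.
  have [y yE] := fin_all_exists (fun a => p_surj (u a)).
  by exists (finfun y); apply/ffunP=> a; rewrite !ffunE.
have kerp (y : Y^K) : ffun_map _ p y = 0 -> exists u : X'^K, ffun_map _ i u = y.
  move=> /ffunP y0; have y0' a : exists u, i u = y a.
    by apply/ip; have := y0 a; rewrite !ffunE.
  have [u uE] := fin_all_exists y0'.
  by exists (finfun u); apply/ffunP=> a; rewrite !ffunE.
have iK_inj : injective (ffun_map 'I_d i).
  by move=> u w /ffunP uw; apply/ffunP=> a; apply: i_inj; have := uw a; rewrite !ffunE.
have [y yE] := lift x.
have [|x' x'E] := kerp (op y); first by rewrite op_map yE x0.
have Dx' : op x' = 0 by apply: iK_inj; rewrite op_map x'E op_op linear0.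
pose js1 := take t js; pose js2 := drop t js.
have sz1 : size js1 = t by rewrite size_takel // sz_js leq_addr.
have sz2 : size js2 = s by rewrite size_drop sz_js addKn.
have [x2 x2E] := X's x' Dx' js2 sz2.
pose z := word k js2 *: y - ((-1) ^+ s : L) *: ffun_map _ i x2.
have Dz : op z = 0.
  rewrite op_additive op_word sz2 op_sign -op_map x2E (linearZZ (ffun_map _ i)).
  by rewrite x'E subrr.
have [w wE] := Yt z Dz js1 sz1; exists (ffun_map _ p w).
rewrite -op_map wE (linearZZ (ffun_map _ p)) linearB !(linearZZ (ffun_map _ p)) yE.
have -> : ffun_map _ p (ffun_map _ i x2) = 0 :> X^K.
  by apply/ffunP=> a; rewrite !ffunE; apply/ip; exists (x2 a).
by rewrite scaler0 subr0 scalerA /word -big_cat cat_take_drop.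
Qed.

Lemma kills_retract V W s : retract W V -> kills V s -> kills W s.
Proof.
case=> i [r ir] Vs x x0 js sz_js.
have [|y yE] := Vs (ffun_map _ i x) _ js sz_js; first by rewrite -op_map x0 linear0.
exists (ffun_map _ r y); rewrite -op_map yE linearZ; congr (_ *: _).
by apply/ffunP=> a; rewrite !ffunE ir.
Qed.

Lemma kills_ffun V (I : finType) s : kills V s -> kills {ffun I -> V} s.
Proof.
move=> Vs x x0 js sz_js; pose ev i := ffun_map 'I_d (ev_map V (i : I)).
have Dev i : op (ev i x) = 0 by rewrite -op_map x0 linear0.
have [y yE] := fin_all_exists (fun i => Vs (ev i x) (Dev i) js sz_js).
pose w : {ffun I -> V}^K := [ffun a => [ffun i => y i a]].
have evw i : ev i w = y i by apply/ffunP=> a; rewrite /ev ffunE /= !ffunE.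
exists w; apply/ffunP=> a; apply/ffunP=> i.
have /ffunP/(_ a) : ev i (op w) = word k js *: ev i x by rewrite op_map evw yE.
by rewrite /ev !ffunE /=.
Qed.

Lemma kills_in_add V W s : in_add V W -> kills V s -> kills W s.
Proof. by case/in_addP=> I WV Vs; apply: kills_retract WV (kills_ffun (I := I) Vs). Qed.

Lemma kills_trivial X s : (forall x : X, x = 0) -> kills X s.
Proof.
move=> X0 x _ js _; exists 0; rewrite raddf0; apply/ffunP=> a.
by rewrite [LHS]X0 [RHS]X0.
Qed.

(** Exactness of op on free modules: contraction against a form not vanishing
    at lam is a contracting homotopy up to a scalar. *)
Lemma kills_free j : lam j != 0 -> kills L^o 0.
Proof.
move=> lam_j x x0 [] // _; rewrite /word big_nil scale1r.
pose h (u : L^o^K) : L^o^K := [ffun a => contract j (u a)].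
have cZ (a : k) (y : L) : contract j ((a%:A : L) * y) = (a%:A : L) * contract j y.
  have := contract_linear j a y 0; rewrite !addr0 !ext_algl => ->.
  rewrite [X in _ + X](_ : _ = 0) ?addr0 //.
  by apply/ffunP=> S; rewrite !ffunE mulr0 if_same.
have c0 : contract j (0 : L) = 0.
  by apply/ffunP=> S; rewrite !ffunE mulr0 if_same.
have cD (y z : L) : contract j (y + z) = contract j y + contract j z.
  by have := contract_linear j 1 y z; rewrite !scale1r.
have cS (I : finType) (F : I -> L) : contract j (\sum_i F i) = \sum_i contract j (F i).
  exact: (big_morph _ cD c0).
have h_act c u : h (act c u) = act c (h u).
  by apply/ffunP=> a; rewrite !ffunE cS; apply: eq_bigr => e _; rewrite cZ ffunE.
have hS (I : finType) (F : I -> L^o^K) : h (\sum_i F i) = \sum_i h (F i).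
  apply/ffunP=> a; rewrite ffunE !sum_ffunE cS.
  by apply: eq_bigr => i _; rewrite ffunE.
have homotopy u : op (h u) + h (op u) = act (lam j) u.
  rewrite hS -big_split (bigD1 j) //= big1 ?addr0 => [|i ne_ij].
    rewrite h_act -linearD; congr (act _ _); apply/ffunP=> a.
    by rewrite !ffunE [LHS]contract_gen eqxx scale1r.
  rewrite h_act -linearD -[RHS](linear0 (@act L^o (lam i))); congr (act _ _).
  by apply/ffunP=> a; rewrite !ffunE [LHS]contract_gen (negPf ne_ij) scale0r.
exists (act (lam j)^-1 (h x)); rewrite op_act.
have -> : op (h x) = act (lam j) x.
  rewrite -homotopy x0; have -> : h 0 = 0 by apply/ffunP=> a; rewrite !ffunE c0.
  by rewrite addr0.
by rewrite actA mulVf // act1.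
Qed.

Lemma kills_projective j P : lam j != 0 -> fin_gen P -> projective P -> kills P 0.
Proof.
move=> lam_j /fin_genP[I [f f_surj]] /(_ _ _ f idfun f_surj)[h hf].
apply: kills_retract (kills_ffun (I := I) (kills_free lam_j)).
by exists h, f.
Qed.

Lemma kills_syzygy j p X Y s : lam j != 0 -> is_syzygy p X Y ->
  kills Y s -> kills X s.
Proof.
move=> lam_j; elim: p X Y => [|p IHp] X Y /=.
  case=> f /bij_linear_inverse[g [fK gK]]; apply: kills_retract.
  by exists g, f.
case=> Z [XZ [P [q [i [[P_fg P_proj [q_surj _]] i_inj iq]]]]] Ys.
apply: IHp XZ _; rewrite -[s]add0n.
exact: kills_extension i_inj iq q_surj Ys (kills_projective lam_j P_fg P_proj).
Qed.

Lemma kills_ker (A B C : lmodType L) (f : {linear A -> B}) (g : {linear B -> C}) s :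
    exact_at f g -> kills (submod_of (ker_mod f)) s -> kills A 1 ->
  kills (submod_of (ker_mod g)) s.+1.
Proof.
move=> fg fs A1; have gf x : g (f x) = 0 by apply/fg; exists x.
pose f' x := @submod_mk _ _ (ker_mod g) _ (gf x).
have f'_lin : linear f' by move=> a x y; apply: val_inj; exact: (linearP f).
rewrite -add1n; apply: (kills_extension (i := submod_incl (ker_mod f))
  (p := mk_linear f'_lin)) => //.
- exact: ker_incl_inj.
- move=> x; rewrite -(ker_incl_exact f x).
  by split=> fx; [exact: (congr1 submod_val fx)|exact: val_inj].
move=> y; have /fg[x xE] := submod_valP y; exists x; exact: val_inj.
Qed.

(** Each of the m + 1 terms of the resolution costs one generator, from the
    injective end, where the kernel is 0, up to X. *)
Lemma kills_resolution V m X : kills V 1 -> add_resolution V m X -> kills X m.+1.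
Proof.
move=> V1 [W [D [e [WV W0 DD De e_surj]]]].
have W1 i : kills (W i) 1.
  have [le_im|lt_mi] := leqP i m; first exact: kills_in_add (WV i le_im) V1.
  exact: kills_trivial (W0 i lt_mi).
(* W m is the last term that may be nonzero, and the kernel inside it is 0. *)
have kerD_start (A B C : lmodType L) (f : {linear A -> B}) (g : {linear B -> C}) :
    (forall x : A, x = 0) -> exact_at f g -> kills (submod_of (ker_mod g)) 0.
  move=> A0 fg; apply: kills_trivial => x; apply: val_inj.
  by have /fg[y yE] := submod_valP x; rewrite -[LHS]yE (A0 y) linear0.
have kerD s i : (m <= i.+1 + s)%N -> kills (submod_of (ker_mod (D i))) s.
  elim: s i => [|s IHs] i le_m.
    by apply: kerD_start (DD i) => // w; apply: (W0 i.+2); rewrite ltnS -[i.+1]addn0.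
  by apply: kills_ker (DD i) (IHs i.+1 _) (W1 _); rewrite addSnnS.
have kere : kills (submod_of (ker_mod e)) m.
  case: m WV W0 kerD => [|m] WV W0 kerD; first exact: kerD_start (W0 1%N isT) De.
  exact: kills_ker De (kerD m 0%N _) (W1 _).
rewrite -add1n; apply: kills_extension (@ker_incl_inj _ _ _ e) _ e_surj kere (W1 _).
exact: ker_incl_exact.
Qed.

Lemma ker_op0 : op (0 : L^o^K) = 0. Proof. exact: raddf0. Qed.
Lemma ker_opP (y : L) (u w : L^o^K) : op u = 0 -> op w = 0 -> op (y *: u + w) = 0.
Proof. by move=> Du Dw; rewrite raddfD /= op_scale0 // Dw addr0. Qed.
(** For lam <> 0 this is, up to isomorphism of L-modules, the quotient of the
    exterior algebra of K^n by the ideal generated by lam. *)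
Definition ker_op := Submod ker_op0 ker_opP.

Variable b' : 'I_d -> K.
Hypothesis Casimir : forall c a,
  \sum_(e < d) coord b a (c * b`_e) *: b' e = c * b' a.
Hypothesis Casimir_neq0 : \sum_(a < d) b`_a * b' a != 0.

Lemma act_sum X (I : finType) (F : I -> K) (x : X^K) :
  act (\sum_i F i) x = \sum_i act (F i) x.
Proof.
by apply: (big_morph (fun c => act c x)) => [c c'|]; [exact: actDl|exact: act0l].
Qed.

(** The product of the generators other than e_j is nonzero on homology. The class
    witnessing this is the Casimir element applied to lam: it is a cycle since lam
    may be moved across the tensor product and squares to 0. The product map
    M_K -> M sends boundaries to 0, and this cycle to a nonzero multiple of lam. *)
Lemma ker_op_not_killed j : lam j != 0 -> ~ kills (submod_of ker_op) n.-1.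
Proof.
move=> lam_j M_killed.
pose one : L^o^K := [ffun a => (coord b a 1)%:A].
pose v := op one; have Dv : op v = 0 by rewrite op_op.
have in_ker c : op (act c v) = 0 by rewrite op_act Dv linear0.
pose z : (submod_of ker_op)^K :=
  [ffun a => @submod_mk _ _ ker_op (act (b' a) v) (in_ker _)].
pose incl := submod_incl ker_op.
have Dz : op z = 0.
  apply/ffunP=> a; apply: val_inj.
  transitivity (\sum_i gen k i *: act (lam i * b' a) v).
    rewrite sum_ffunE [LHS](linear_sum incl); apply: eq_bigr => i _.
    rewrite ffunE [LHS](linear_sum incl) -Casimir act_sum scaler_sumr.
    apply: eq_bigr => e _; rewrite linearZZ ffunE linearZZ ffunE /=.
    rewrite -[_ *: b' e]mulr_algl -actA act_alg scalerA [in RHS]scalerA.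
    by rewrite ext_algl ext_algr.
  rewrite ffunE /=; transitivity (act (b' a) (op v)); last by rewrite Dv linear0.
  rewrite linear_sum; apply: eq_bigr => i _.
  by rewrite [RHS]actA mulrC -linearZZ.
pose mu (x : (submod_of ker_op)^K) : L^o^K := \sum_(a < d) act b`_a (incl (x a)).
have mu_act c x : mu (act c x) = act c (mu x).
  transitivity (\sum_(e < d) \sum_(a < d)
      act (b`_a * (coord b a (c * b`_e))%:A) (incl (x e))).
    rewrite exchange_big; apply: eq_bigr => a _.
    rewrite ffunE [incl _]linear_sum [LHS]linear_sum; apply: eq_bigr => e _.
    by rewrite -[RHS]actA act_alg (linearZZ incl).
  rewrite [RHS]linear_sum; apply: eq_bigr => e _; rewrite -act_sum [RHS]actA.
  rewrite [in RHS](coord_basis b_basis (memvf (c * b`_e))); congr (act _ _).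
  by apply: eq_bigr => a _; rewrite -scalerAr mulr1.
have mu_scale (y : L) x : mu (y *: x) = y *: mu x.
  rewrite scaler_sumr; apply: eq_bigr => a _.
  by rewrite ffunE (linearZZ incl); exact: (linearZZ (@act L^o _)).
have muD x y : mu (x + y) = mu x + mu y.
  by rewrite -big_split; apply: eq_bigr => a _; rewrite ffunE !linearD.
have mu0 : mu 0 = 0 by rewrite /mu big1 // => a _; rewrite ffunE !linear0.
have mu_op x : mu (op x) = 0.
  have -> : mu (op x) = op (mu x).
    by rewrite (big_morph mu muD mu0); apply: eq_bigr => i _; rewrite mu_act mu_scale.
  rewrite (big_morph (@op L^o) (@raddfD _ _ (@op L^o)) (raddf0 (@op L^o))).
  by rewrite big1 // => a _; rewrite op_act (submod_valP (x a)) linear0.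
pose js := [seq i <- enum 'I_n | i != j].
have js_uniq : uniq js by rewrite filter_uniq // enum_uniq.
have sz_js : size js = n.-1.
  have -> : js = rem j (enum 'I_n) by rewrite rem_filter // enum_uniq.
  by rewrite size_rem ?mem_enum // size_enum_ord.
have [y yE] := M_killed z Dz js sz_js.
pose u := \sum_(a < d) b`_a * b' a.
have word_v : word k js *: v = 0.
  have : act u (word k js *: v) = 0.
    rewrite /u act_sum -[RHS](mu_op y) yE /mu; apply: eq_bigr => a _.
    rewrite !ffunE -[LHS]actA (linearZZ incl); congr (act _ _).
    exact: (linearZZ (@act L^o _)).
  move/(congr1 (act u^-1)); rewrite actA linear0 mulVf // act1 //.
have b_free := basis_free b_basis.
have vE a : v a = \sum_i (coord b a (lam i)) *: gen k i.
  rewrite sum_ffunE; apply: eq_bigr => i _; rewrite linearZZ ffunE.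
  rewrite -[RHS]ext_algr; congr (_ * _).
  have <- : \sum_(e < d) coord b a (lam i * b`_e) * coord b e 1 = coord b a (lam i).
    rewrite -{2}[lam i]mulr1 [X in lam i * X](coord_basis b_basis (memvf 1)).
    rewrite mulr_sumr linear_sum; apply: eq_bigr => e _.
    by rewrite -scalerAr linearZ /= mulrC.
  rewrite ffunE scaler_suml; apply: eq_bigr => e _.
  by rewrite ffunE [LHS]ext_algl scalerA.
case/negP: lam_j; apply/eqP; rewrite (coord_basis b_basis (memvf (lam j))).
rewrite big1 // => a _.
have : (word k js *: v) a = 0 by rewrite word_v ffunE.
rewrite ffunE vE [_ *: _]mulr_sumr (bigD1 j) //= big1 ?addr0 => [|i ne_ij]; last first.
  rewrite -scalerAr word_gen0 ?scaler0 //.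
  by rewrite mem_filter ne_ij mem_enum.
move/eqP; rewrite -scalerAr scaler_eq0 (negPf (word_gen_neq0 _ js_uniq _)).
  by rewrite orbF => /eqP->; rewrite scale0r.
by rewrite mem_filter eqxx.
Qed.
End ScalarExtension.

(** * The lower bound *)

Lemma vector_basis (k : fieldType) (X : lmodType k) : fin_gen X ->
  exists D (g : 'I_D -> X),
    (forall x, exists c : 'I_D -> k, x = \sum_s c s *: g s) /\
    forall c : 'I_D -> k, \sum_s c s *: g s = 0 -> forall s, c s = 0.
Proof.
case/minimal_generators=> D [g [gP gmin]]; exists D, g; split=> // c c0 s.
by apply/eqP; apply: contraT => cs; have := gmin c c0 s (c s)^-1; rewrite mulVf ?eqxx.
Qed.

(** In coordinates, op is the combination of the matrices N i of the generators
    with coefficients lam. Choose lam of largest rank; then [max_rank_tangent] in the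
    direction N i says that e_i maps cycles to boundaries. *)
Lemma generic_kills (k : fieldType) n (V : lmodType (exterior k n)) :
    (0 < n)%N -> fin_gen V ->
  exists m, forall (K : fieldExtType k) d (b : d.-tuple K) (r : seq K),
    basis_of {:K} b -> uniq r -> (m <= size r)%N ->
    exists (lam : 'I_n -> K) (j : 'I_n), lam j != 0 /\ kills b lam V 1.
Proof.
move=> n_gt0 /fin_gen_restr/vector_basis[D [g [gP g_free]]].
exists D.+3 => K d b r b_basis r_uniq sz_r.
have /fin_all_exists[N0 N0P] (i : 'I_n) : exists N : 'I_D -> 'I_D -> k,
    forall s, gen k i *: (g s : V) = \sum_t (N s t) *: (g t : restr V).
  exact: fin_all_exists (fun s => gP (gen k i *: (g s : V))).
pose N i : 'M[K]_D := \matrix_(s, t) (N0 i s t)%:A.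
pose Nlam (lam : 'I_n -> K) := \sum_i lam i *: N i.
pose P q := `[< exists lam, (exists j, lam j != 0) /\ \rank (Nlam lam) = q >].
have exP : exists q, P q.
  exists (\rank (Nlam (fun _ => 1))); apply/asboolP; exists (fun _ => 1); split=> //.
  by exists (Ordinal n_gt0); rewrite oner_eq0.
have [|q /asboolP[lam [[j lam_j] lam_q]] max_q] := @ex_maxnP P D exP.
  by move=> q /asboolP[lam [_ <-]]; exact: rank_leq_row.
exists lam, j; split=> //.
have rank_max i t : (\rank (Nlam lam + t *: N i)%R <= \rank (Nlam lam))%N.
  pose lam' l := lam l + (if l == i then t else 0).
  have -> : Nlam lam + t *: N i = Nlam lam'.
    rewrite /Nlam /lam'; under [RHS]eq_bigr do rewrite scalerDl.
    rewrite big_split; congr (_ + _) => /=.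
    rewrite (bigD1 i) //= eqxx big1 ?addr0 // => l /negPf->; exact: scale0r.
  have [[l lam'_l]|lam'_0] := pselect (exists l, lam' l != 0).
    by rewrite lam_q; apply: max_q; apply/asboolP; exists lam'; split=> //; exists l.
  rewrite /Nlam big1 ?mxrank0 // => l _; have [->|nz] := eqVneq (lam' l) 0.
    by rewrite scale0r.
  by case: lam'_0; exists l.
(* The isomorphism of the coordinate space over K with the scalar extension. *)
pose phi (X : 'rV[K]_D) : {ffun 'I_d -> restr V} :=
  [ffun a => \sum_s coord b a (X 0 s) *: g s].
have phi_gen i X : gen k i *: (phi X : {ffun 'I_d -> V}) = phi (X *m N i).
  apply/ffunP=> a; rewrite !ffunE scaler_sumr.
  transitivity (\sum_s \sum_t (coord b a (X 0 s) * N0 i s t) *: g t).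
    apply: eq_bigr => s _.
    rewrite restr_scaleE scalerA ext_algr -ext_algl -scalerA N0P.
    rewrite -[LHS]restr_scaleE scaler_sumr; apply: eq_bigr => t _.
    by rewrite scalerA.
  rewrite exchange_big; apply: eq_bigr => t _ /=; rewrite -scaler_suml.
  congr (@GRing.scale k (restr V) _ _).
  rewrite mxE linear_sum; apply: eq_bigr => s _; rewrite mxE.
  by rewrite -scalerAr mulr1 linearZ /= mulrC.
have phi_act c X : act b c (phi X : {ffun 'I_d -> V}) = phi (c *: X).
  apply/ffunP=> a; rewrite !ffunE.
  transitivity (\sum_(e < d) \sum_s (coord b a (c * b`_e) * coord b e (X 0 s)) *: g s).
    apply: eq_bigr => e _; rewrite ffunE -[LHS]restr_scaleE scaler_sumr.
    by apply: eq_bigr => s _; rewrite scalerA.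
  rewrite exchange_big; apply: eq_bigr => s _; rewrite -scaler_suml.
  congr (@GRing.scale k (restr V) _ _).
  rewrite mxE [in RHS](coord_basis b_basis (memvf (X 0 s))) mulr_sumr linear_sum.
  by apply: eq_bigr => e _; rewrite -scalerAr linearZ /= mulrC.
have phiD X Y : phi (X + Y) = phi X + phi Y.
  apply/ffunP=> a; rewrite !ffunE -big_split; apply: eq_bigr => s _ /=.
  by rewrite mxE linearD scalerDl.
have phi0 : phi 0 = 0.
  by apply: (addrI (phi 0)); rewrite -phiD !addr0.
have phi_op X : op b lam (phi X : {ffun 'I_d -> V}) = phi (X *m Nlam lam).
  rewrite /Nlam mulmx_sumr (big_morph phi phiD phi0); apply: eq_bigr => i _.
  by rewrite phi_gen phi_act scalemxAr.
have phi_surj (x : {ffun 'I_d -> restr V}) : exists X, phi X = x.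
  have [c cE] := fin_all_exists (fun a => gP (x a)).
  exists (\row_s \sum_(a < d) c a s *: b`_a); apply/ffunP=> a.
  rewrite ffunE cE; apply: eq_bigr => s _; rewrite mxE.
  by rewrite coord_sum_free // (basis_free b_basis).
have phi_inj X : phi X = 0 -> X = 0.
  move=> /ffunP X0; apply/rowP=> s; rewrite mxE (coord_basis b_basis (memvf (X 0 s))).
  rewrite big1 // => a _; have := X0 a; rewrite !ffunE => /g_free/(_ s) ->.
  exact: scale0r.
move=> x Dx [|i []] // _; have [X xE] := phi_surj x.
have XN0 : X *m Nlam lam = 0 by apply: phi_inj; rewrite -phi_op xE.
have /submxP[Y YE] := max_rank_tangent r_uniq sz_r (rank_max i) XN0.
by exists (phi Y); rewrite phi_op -YE -phi_gen xE /word big_seq1.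
Qed.

Lemma Igusa_Todorov_lower_bound (k : fieldType) n m p :
  (0 < n)%N -> Igusa_Todorov (exterior k n) m p -> (n.-1 <= m)%N.
Proof.
move=> n_gt0 [V [V_fg V_IT]]; rewrite leqNgt; apply/negP => lt_m.
have [D lamP] := generic_kills n_gt0 V_fg.
have [K [d [b [b' [b_basis Casimir Casimir0 [r r_uniq sz_r]]]]]] :=
  large_separable_extension k D.
have [lam [j [lam_j V1]]] := lamP K d b r b_basis r_uniq sz_r.
have M_fg : fin_gen (submod_of (ker_op b_basis lam)).
  by apply: exterior_noetherian; exact: fin_gen_free.
have [X [MX X_res]] := V_IT _ M_fg.
apply: (ker_op_not_killed Casimir Casimir0 lam_j).
apply: kills_le lt_m _; apply: (kills_syzygy b_basis lam_j MX).
exact: kills_resolution V1 X_res.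
Qed.

Theorem theorem1p1 (k : fieldType) (n : nat) (n_gt0 : (0 < n)%N) :
  IT_dist (exterior k n) = Some (n - 1)%N.
Proof.
rewrite subn1; apply/inf_natP; split.
  by exists 1%N; exact: exterior_Igusa_Todorov.
by move=> m [p]; exact: Igusa_Todorov_lower_bound.
Qed.
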